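(* There exist an absolute constant $C>0$ and, for every $M>0$, a constant $c_M>0$ depending only on $M$, such that the following holds. Let $d\ge 1$, $p\in[1,\infty]$, $\mu>0$, $M>0$, $\varepsilon>0$, $\sigma\in(0,1)$. Let $X\subset\mathbb{R}^d$ be a convex set, let $\xi$ be a random variable, and let $f(x,\xi)\ge 0$ be convex in $x$ on $X$ for every $\xi$ and satisfy, for all $x,y\in X$ and all $\xi$, $$|f(y,\xi)-f(x,\xi)|\le M\|y-x\|_p .$$ Put $F(x)=\mathbb{E}_\xi f(x,\xi)$. Let $\xi^1,\dots,\xi^N$ be i.i.d. copies of $\xi$, put $\hat F(x)=\frac1N\sum_{k=1}^N f(x,\xi^k)$, and suppose $$N\ \ge\ C\,\frac{M^2}{\mu\varepsilon}\left(\ln\left(\frac{M^2}{\mu\varepsilon}\right)+\ln\ln\left(\frac1\sigma\right)\right)\ln\left(\frac1\sigma\right),\qquad 0\le\delta\le c_M\,\mu\varepsilon^2 .$$ Assume the quadratic growth conditions: for all $x\in X$ and all realizations $\{\xi^k\}_{k=1}^N$, $$\hat F(x)-\hat F(\hat x_* )\ge\frac{\mu}{2}\|x-\hat x_*\|_p^2,$$ where $\hat x_*$ is the projection of $x$ onto the set of solutions of $\min_{x\in X}\hat F(x)$; and for all $x\in X$, $$F(x)-F(x_* )\ge\frac{\mu}{2}\|x-x_*\|_p^2,$$ where $x_*$ is the projection of $x$ onto the set of solutions of $\min_{x\in X}F(x)$. Let $x(\{\xi^k\}_{k=1}^N)\in X$ be any (measurable) function of the sample such that $$\mathbb{P}\left(\hat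 F\left(x(\{\xi^k\}_{k=1}^N)\right)-\min_{x\in X}\hat F(x)\le\delta\right)\ge 1-\frac{\sigma}{2}.$$ Then $$\mathbb{P}\left(F\left(x(\{\xi^k\}_{k=1}^N)\right)-\min_{x\in X}F(x)\le\varepsilon\right)\ge 1-\sigma .$$
   Context: $\|\cdot\|_p$ is the $\ell_p$-norm on $\mathbb{R}^d$. Projection of $x$ onto a set means a nearest point of the set to $x$ in the $p$-norm. The minima of $F$ and $\hat F$ over $X$ are assumed to be attained. Convention for the lower bound on $N$: each logarithmic factor $\ln(M^2/(\mu\varepsilon))$, $\ln\ln(1/\sigma)$, $\ln(1/\sigma)$ is understood as the maximum of itself and $1$. *)

(* Defs.v *)
From HB Require Import structures.
From mathcomp Require Import all_boot all_order all_algebra.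
From mathcomp Require Import all_classical all_reals all_analysis.

Set Implicit Arguments.
Unset Strict Implicit.
Unset Printing Implicit Defensive.

Import Order.TTheory GRing.Theory Num.Theory.

Local Open Scope classical_set_scope.
Local Open Scope ring_scope.

(* Only used for p in [1, +oo]; the value at -oo is junk. *)
Definition lp_norm (R : realType) (d : nat) (p : \bar R) (x : 'rV[R]_d) : R :=
  match p with
  | r%:E%E => (\sum_(i < d) `|x 0 i| `^ r) `^ r^-1
  | +oo%E => \big[Num.max/0]_(i < d) `|x 0 i|
  | -oo%E => 0
  end.

Definition solutions (R : realType) (T : Type) (X : set T) (G : T -> R) :
    set T :=
  [set x | X x /\ forall y, X y -> G x <= G y].

(* The minimum of G over X as soon as it is attained, i.e. [solutions X G] is
   nonempty. *)
Definition minimum (R : realType) (T : Type) (X : set T) (G : T -> R) : R :=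
  inf [set G x | x in X].

(* For p = 1 and p = +oo a nearest point need not be unique. *)
Definition is_projection (R : realType) (d : nat) (p : \bar R)
    (A : set 'rV[R]_d) (x y : 'rV[R]_d) : Prop :=
  A y /\ forall z, A z -> lp_norm p (x - y) <= lp_norm p (x - z).

(* X is not assumed closed, so the existence of a projection onto the solution
   set is part of the condition; the choice of the projection is immaterial,
   since both sides of the inequality only depend on min G, G x and the
   distance from x to the solution set. *)
Definition quadratic_growth (R : realType) (d : nat) (p : \bar R) (mu : R)
    (X : set 'rV[R]_d) (G : 'rV[R]_d -> R) : Prop :=
  forall x, X x ->
    (exists xs, is_projection p (solutions X G) x xs) /\
    (forall xs, is_projection p (solutions X G) x xs ->
       mu / 2 * lp_norm p (x - xs) ^+ 2 <= G x - G xs).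

Definition mutually_independent (dO dS : measure_display)
    (Omega : measurableType dO) (S : measurableType dS) (R : realType)
    (P : probability Omega R) (I : finType) (Y : I -> {RV P >-> S}) : Prop :=
  forall (J : {set I}) (A : I -> set S), (forall i, measurable (A i)) ->
    P (\bigcap_(i in [set` J]) (Y i @^-1` A i)) =
    (\prod_(i in J) P (Y i @^-1` A i))%E.

Definition same_law (dO dS : measure_display)
    (Omega : measurableType dO) (S : measurableType dS) (R : realType)
    (P : probability Omega R) (Y Z : {RV P >-> S}) : Prop :=
  forall A : set S, measurable A -> distribution P Y A = distribution P Z A.

(* Meaningful at the points x where [f x \o xi] is integrable. *)
Definition expected_objective (dO dS : measure_display)
    (Omega : measurableType dO) (S : measurableType dS) (R : realType)
    (P : probability Omega R) (xi : {RV P >-> S}) (d : nat)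
    (f : 'rV[R]_d -> S -> R) (x : 'rV[R]_d) : R :=
  fine ('E_P[fun w => f x (xi w)])%E.

Definition empirical_objective (S : Type) (R : realType) (d N : nat)
    (f : 'rV[R]_d -> S -> R) (s : N.-tuple S) (x : 'rV[R]_d) : R :=
  N%:R^-1 * \sum_(k < N) f x (tnth s k).

Definition sample (dO dS : measure_display)
    (Omega : measurableType dO) (S : measurableType dS) (R : realType)
    (P : probability Omega R) (N : nat) (Y : 'I_N -> {RV P >-> S})
    (w : Omega) : N.-tuple S :=
  [tuple Y k w | k < N].

Arguments mutually_independent {dO dS Omega S R} P {I} Y.
Arguments same_law {dO dS Omega S R} P Y Z.
Arguments expected_objective {dO dS Omega S R} P xi {d} f x.

(* Main.v *)
Require Import Defs.
From HB Require Import structures.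
From mathcomp Require Import all_boot all_order all_algebra.
From mathcomp Require Import all_classical all_reals all_analysis.
From mathcomp Require Import measurable_realfun.
From mathcomp Require Import zify ring lra.

Set Implicit Arguments.
Unset Strict Implicit.
Unset Printing Implicit Defensive.

Import Order.TTheory GRing.Theory Num.Theory.
Import numFieldNormedType.Exports.

Local Open Scope classical_set_scope.
Local Open Scope ring_scope.

(** The empirical minimizer is uniformly stable, and this stability together with
    a concentration inequality for weakly dependent sums gives the fast rate.
    Write [a = M^2 / mu].

    Stability. If two samples differ in one observation, then by the growth
    condition every empirical minimizer for one is within [4 M / (mu N)] of an
    empirical minimizer for the other ([solution_swap]). Minimizers need not be
    unique, but replacing the observations one after the other by a fixed [z]
    and summing shows that each loss [f _ z] oscillates by [O(a / N)] only on
    the set of empirical minimizers ([solutions_flat]). Hence the losses at any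
    choice of approximate empirical minimizer change by [O(a / N)] when one
    observation does ([approx_minimizer_stable]). The same argument bounds the
    difference of the losses at two points by the square roots of their
    empirical suboptimalities ([approx_minimizers_flat]).

    Concentration. Let [x s] be an approximate minimizer for the sample [s] and
    [xs] a minimizer of [F]. Up to [O(a)], [N (F (x s) - F xs)] is at most the
    sum of the generalization errors [g i] at the observations of [s], where
    [x] is computed after replacing the [i]-th observation by a fixed one. Thus
    [g i] has mean zero in the [i]-th coordinate and changes by [O(a / N)] with
    each of the others, and a dyadic decomposition of the set of observations
    shows that the sum of the [g i], less the sum of their projections on single
    coordinates, has exponential moments at scale [O(a ln N)]
    ([avg_expR_sum_deviation]). The projections are independent and of size
    [O(a / N^(1/2))], so their sum is of scale [O(a)]
    ([int_expR_weakly_dependent_sum]). Therefore the excess risk is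
    [O((a / N) ln N ln (1 / sigma))] with probability [1 - sigma / 2]
    ([excess_risk_tail]), which is at most a fraction of [eps] for the given [N]
    ([sample_size_suffices]).

    A point that is [delta]-optimal for the sample has losses within
    [O(a / N + M (delta / mu)^(1/2))] of those at [x s], and this is how the
    bound on [delta] enters. No measurability issue arises from [x]: it is
    chosen among the values of a dense sequence
    ([exists_measurable_approx_minimizer]). *)

(** * Bounded measurable functions and their integrals *)

(** Real functions that are measurable and bounded: the class on which all the
    expectations below are taken, so that integrability is automatic. *)
Definition bounded_measurable d (T : measurableType d) (R : realType)
    (g : T -> R) : Prop :=
  measurable_fun setT g /\ exists b : R, forall t, `|g t| <= b.

Section bounded_measurable_closure.
Context d (T : measurableType d) (R : realType).
Implicit Types g h : T -> R.

Lemma bounded_measurable_cst (c : R) : bounded_measurable (fun _ : T => c).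
Proof. by split; [exact: measurable_cst|exists `|c|]. Qed.

Lemma bounded_measurableD g h : bounded_measurable g -> bounded_measurable h ->
  bounded_measurable (fun t => g t + h t).
Proof.
move=> [mg [b gb]] [mh [c hc]]; split; first exact: measurable_funD.
by exists (b + c) => t; rewrite (le_trans (ler_normD _ _))// lerD.
Qed.

Lemma bounded_measurableM g h : bounded_measurable g -> bounded_measurable h ->
  bounded_measurable (fun t => g t * h t).
Proof.
move=> [mg [b gb]] [mh [c hc]]; split; first exact: measurable_funM.
by exists (b * c) => t; rewrite normrM ler_pM.
Qed.

Lemma bounded_measurableN g : bounded_measurable g ->
  bounded_measurable (fun t => - g t).
Proof.
move=> [mg [b gb]]; split; first exact: measurable_funN.
by exists b => t; rewrite normrN.
Qed.

Lemma bounded_measurableB g h : bounded_measurable g -> bounded_measurable h ->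
  bounded_measurable (fun t => g t - h t).
Proof.
by move=> bg bh; apply: bounded_measurableD => //; exact: bounded_measurableN.
Qed.

Lemma bounded_measurableZ c g : bounded_measurable g ->
  bounded_measurable (fun t => c * g t).
Proof. by apply: bounded_measurableM; exact: bounded_measurable_cst. Qed.

Lemma bounded_measurableX g n : bounded_measurable g ->
  bounded_measurable (fun t => g t ^+ n).
Proof.
move=> [mg [b gb]]; split; first exact: measurable_funX.
by exists (b ^+ n) => t; rewrite normrX lerXn2r ?nnegrE// (le_trans _ (gb t)).
Qed.

Lemma bounded_measurable_norm g : bounded_measurable g ->
  bounded_measurable (fun t => `|g t|).
Proof.
move=> [mg [b gb]]; split; first exact: measurableT_comp.
by exists b => t; rewrite normr_id.
Qed.

Lemma bounded_measurable_expR g : bounded_measurable g ->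
  bounded_measurable (fun t => expR (g t)).
Proof.
move=> [mg [b gb]]; split; first exact: measurableT_comp.
exists (expR b) => t; rewrite ger0_norm ?expR_ge0// ler_expR.
exact: le_trans (ler_norm _) (gb t).
Qed.

Lemma bounded_measurable_sum (I : Type) (r : seq I) (p : pred I)
    (g : I -> T -> R) : (forall i, p i -> bounded_measurable (g i)) ->
  bounded_measurable (fun t => \sum_(i <- r | p i) g i t).
Proof.
move=> bg; elim: r => [|i r ih].
  have -> : (fun t => \sum_(i <- [::] | p i) g i t) = cst 0.
    by apply/funext => t /=; rewrite big_nil.
  exact: bounded_measurable_cst.
have -> : (fun t => \sum_(j <- i :: r | p j) g j t) =
    (fun t => if p i then g i t + \sum_(j <- r | p j) g j t
              else \sum_(j <- r | p j) g j t).
  by apply/funext => t /=; rewrite big_cons.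
by case: (boolP (p i)) => pi //; apply: bounded_measurableD => //; exact: bg.
Qed.

Lemma bounded_measurable_prod (I : Type) (r : seq I) (p : pred I)
    (g : I -> T -> R) : (forall i, p i -> bounded_measurable (g i)) ->
  bounded_measurable (fun t => \prod_(i <- r | p i) g i t).
Proof.
move=> bg; elim: r => [|i r ih].
  have -> : (fun t => \prod_(i <- [::] | p i) g i t) = cst 1.
    by apply/funext => t /=; rewrite big_nil.
  exact: bounded_measurable_cst.
have -> : (fun t => \prod_(j <- i :: r | p j) g j t) =
    (fun t => if p i then g i t * \prod_(j <- r | p j) g j t
              else \prod_(j <- r | p j) g j t).
  by apply/funext => t /=; rewrite big_cons.
by case: (boolP (p i)) => pi //; apply: bounded_measurableM => //; exact: bg.
Qed.

Lemma bounded_measurable_comp d' (T' : measurableType d') (u : T' -> T) g :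
  measurable_fun setT u -> bounded_measurable g ->
  bounded_measurable (fun t => g (u t)).
Proof.
move=> mu [mg [b gb]]; split; first exact: measurableT_comp.
by exists b.
Qed.

End bounded_measurable_closure.

Section bounded_measurable_integral.
Context d (T : measurableType d) (R : realType) (P : probability T R).
Implicit Types g h : T -> R.

Lemma bounded_measurable_integrable g : bounded_measurable g ->
  P.-integrable setT (EFin \o g).
Proof.
move=> [mg [b gb]]; apply: measurable_bounded_integrable => //.
  by rewrite [X in (X < _)%E](@probability_setT _ _ _ P) ltry.
by exists b; split; [exact: num_real|move=> x bx t _; exact: le_trans (gb t) (ltW bx)].
Qed.

Lemma bm_intD g h : bounded_measurable g -> bounded_measurable h ->
  \int[P]_t (g t + h t) = \int[P]_t g t + \int[P]_t h t.
Proof.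
by move=> bg bh; rewrite RintegralD//; exact: bounded_measurable_integrable.
Qed.

Lemma bm_intB g h : bounded_measurable g -> bounded_measurable h ->
  \int[P]_t (g t - h t) = \int[P]_t g t - \int[P]_t h t.
Proof.
by move=> bg bh; rewrite RintegralB//; exact: bounded_measurable_integrable.
Qed.

Lemma bm_intZ c g : bounded_measurable g ->
  \int[P]_t (c * g t) = c * \int[P]_t g t.
Proof.
by move=> bg; rewrite RintegralZl//; exact: bounded_measurable_integrable.
Qed.

Lemma bm_int_cst c : \int[P]_(t in setT) (c : R) = c.
Proof. by rewrite Rintegral_cst// [X in fine X](@probability_setT _ _ _ P) mulr1. Qed.

Lemma le_bm_int g h : bounded_measurable g -> bounded_measurable h ->
  (forall t, g t <= h t) -> \int[P]_t g t <= \int[P]_t h t.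
Proof.
by move=> bg bh gh; apply: le_Rintegral => //; exact: bounded_measurable_integrable.
Qed.

Lemma bm_int_bound c g : bounded_measurable g -> (forall t, `|g t| <= c) ->
  `|\int[P]_t g t| <= c.
Proof.
move=> bg gc; apply: le_trans.
  by apply: le_normr_Rintegral => //; exact: bounded_measurable_integrable.
rewrite -[leRHS]bm_int_cst; apply: le_bm_int => //.
  exact: bounded_measurable_norm.
exact: bounded_measurable_cst.
Qed.

Lemma bm_int_sum (I : Type) (r : seq I) (p : pred I) (g : I -> T -> R) :
  (forall i, p i -> bounded_measurable (g i)) ->
  \int[P]_t (\sum_(i <- r | p i) g i t) = \sum_(i <- r | p i) \int[P]_t g i t.
Proof.
move=> bg; elim: r => [|i r ih].
  rewrite big_nil -[RHS]bm_int_cst; apply: eq_Rintegral => t _.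
  by rewrite big_nil.
rewrite big_cons; case: ifPn => [pi|pi].
  rewrite -ih -bm_intD//; last exact: bounded_measurable_sum.
    by apply: eq_Rintegral => t _; rewrite big_cons pi.
  exact: bg.
by rewrite -ih; apply: eq_Rintegral => t _; rewrite big_cons (negbTE pi).
Qed.

End bounded_measurable_integral.

Section bounded_measurable_fubini.
Context d1 d2 (T1 : measurableType d1) (T2 : measurableType d2) (R : realType).
Variables (P1 : probability T1 R) (P2 : probability T2 R).

Lemma bounded_measurable_int (g : T1 * T2 -> R) : bounded_measurable g ->
  bounded_measurable (fun x => \int[P2]_y g (x, y)).
Proof.
move=> bg; have gx x : bounded_measurable (fun y => g (x, y)).
  exact: (bounded_measurable_comp (pair1_measurable x)).
split; last first.
  case: bg => _ [b gb]; exists b => x.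
  by apply: bm_int_bound => // y; exact: gb.
apply: measurableT_comp => //.
exact: (measurable_fubini_F
  (bounded_measurable_integrable [the probability _ _ of (P1 \x P2)%E] bg)).
Qed.

Lemma bm_int_prod (g : T1 * T2 -> R) : bounded_measurable g ->
  \int[(P1 \x P2)%E]_p g p = \int[P1]_x \int[P2]_y g (x, y).
Proof.
move=> bg.
have gx x : bounded_measurable (fun y => g (x, y)).
  exact: (bounded_measurable_comp (pair1_measurable x)).
rewrite /Rintegral; congr fine.
under [RHS]eq_integral do
  rewrite fineK ?(integrable_fin_num _ (bounded_measurable_integrable _ (gx _)))//.
symmetry; exact: (integral12_prod_meas1
  (bounded_measurable_integrable [the probability _ _ of (P1 \x P2)%E] bg)).
Qed.

End bounded_measurable_fubini.

(** * Partial averages over the coordinates of a sample *)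

(** The sample [s] in which the coordinates in [B] are replaced by those of
    [t]. *)
Definition splice (S : Type) (N : nat) (B : {set 'I_N}) (s t : N.-tuple S) :
    N.-tuple S :=
  [tuple if i \in B then tnth t i else tnth s i | i < N].

(** The coordinates are independent under [Q], in integral form: replacing a
    block of coordinates by those of an independent copy of the sample does not
    change the law. *)
Definition independent_coordinates d (S : measurableType d) (R : realType)
    (N : nat) (Q : probability (N.-tuple S) R) : Prop :=
  forall (B : {set 'I_N}) (g : N.-tuple S -> R), bounded_measurable g ->
    \int[Q]_s \int[Q]_t g (splice B s t) = \int[Q]_s g s.

(** The average of [g] over the coordinates in [B], the others being frozen:
    under independence, the conditional expectation of [g] given the coordinates
    outside [B]. *)
Definition avg d (S : measurableType d) (R : realType) (N : nat)
    (Q : probability (N.-tuple S) R) (B : {set 'I_N}) (g : N.-tuple S -> R)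
    (s : N.-tuple S) : R :=
  \int[Q]_t g (splice B s t).

(** [g] does not depend on the coordinates in [B]. *)
Definition free_of (S T : Type) (N : nat) (B : {set 'I_N})
    (g : N.-tuple S -> T) : Prop :=
  forall s t, g (splice B s t) = g s.

Lemma finset_ind (I : finType) (K : {set I} -> Prop) :
  K finset.set0 ->
  (forall i (A : {set I}), i \notin A -> K A -> K (i |: A)%SET) ->
  forall A, K A.
Proof.
move=> K0 KU A; have [n An] := ubnP #|A|.
elim: n => // n ih in A An *.
have [->//|[i iA]] := set_0Vmem A.
rewrite -(finset.setD1K iA); apply: KU; first by rewrite !inE eqxx.
by apply: ih; rewrite (cardsD1 i A) iA in An.
Qed.

Section splice_theory.
Context (S : Type) (N : nat).
Implicit Types (A B : {set 'I_N}) (s t u : N.-tuple S).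

Lemma tnth_splice B s t i :
  tnth (splice B s t) i = if i \in B then tnth t i else tnth s i.
Proof. by rewrite tnth_mktuple. Qed.

Lemma splice0 s t : splice finset.set0 s t = s.
Proof. by apply: eq_from_tnth => i; rewrite tnth_splice inE. Qed.

Lemma spliceT s t : splice [set: 'I_N]%SET s t = t.
Proof. by apply: eq_from_tnth => i; rewrite tnth_splice inE. Qed.

Lemma splice_splice A B s t u :
  splice B (splice A s t) u = splice (A :|: B)%SET s (splice B t u).
Proof.
apply: eq_from_tnth => i; rewrite !tnth_splice !inE.
by case: (i \in A); case: (i \in B).
Qed.

Lemma splice_id A B s t u : A \subset B ->
  splice B (splice A s t) u = splice B s u.
Proof.
move=> /fintype.subsetP AB; apply: eq_from_tnth => i; rewrite !tnth_splice.
by have := AB i; case: (i \in A); case: (i \in B) => // /(_ isT).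
Qed.

Lemma free_of_sub (T : Type) A B (g : N.-tuple S -> T) :
  A \subset B -> free_of B g -> free_of A g.
Proof.
move=> AB gB s t; rewrite -[RHS](gB s (splice A s t)); congr (g _).
apply: eq_from_tnth => i; rewrite !tnth_splice.
by move/fintype.subsetP: AB => /(_ i); case: (i \in A); case: (i \in B) => // /(_ isT).
Qed.

End splice_theory.

Section average.
Context d (S : measurableType d) (R : realType) (N : nat).
Variable Q : probability (N.-tuple S) R.
Implicit Types (A B : {set 'I_N}) (g h k : N.-tuple S -> R) (s t : N.-tuple S).
Local Notation E := (avg Q).

Lemma measurable_splice B :
  measurable_fun setT (fun p : N.-tuple S * N.-tuple S => splice B p.1 p.2).
Proof.
apply/measurable_fun_tnthP => i.
rewrite (_ : _ \o _ = if i \in B then (fun p => tnth p.2 i)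
                      else (fun p => tnth p.1 i)).
  by case: ifPn => _; apply: (measurableT_comp (measurable_tnth i)).
by apply/funext => p /=; rewrite tnth_splice; case: ifP.
Qed.

Lemma measurable_splice1 B t : measurable_fun setT (fun s => splice B s t).
Proof. exact: (measurableT_comp (measurable_splice B) (pair2_measurable t)). Qed.

Lemma measurable_splice2 B s : measurable_fun setT (fun t => splice B s t).
Proof. exact: (measurableT_comp (measurable_splice B) (pair1_measurable s)). Qed.

Lemma bm_splice2 B s g : bounded_measurable g ->
  bounded_measurable (fun t => g (splice B s t)).
Proof. exact: (bounded_measurable_comp (measurable_splice2 B s)). Qed.

Lemma bm_avg B g : bounded_measurable g -> bounded_measurable (E B g).
Proof.
move=> bg; have := @bounded_measurable_int _ _ _ _ _ Q Q (fun p => g (splice B p.1 p.2)).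
apply.
exact: (bounded_measurable_comp (measurable_splice B)).
Qed.

Lemma avgD B g h : bounded_measurable g -> bounded_measurable h ->
  E B (fun t => g t + h t) = (fun s => E B g s + E B h s).
Proof. by move=> bg bh; apply/funext => s; rewrite /avg bm_intD//; exact: bm_splice2. Qed.

Lemma avgB B g h : bounded_measurable g -> bounded_measurable h ->
  E B (fun t => g t - h t) = (fun s => E B g s - E B h s).
Proof. by move=> bg bh; apply/funext => s; rewrite /avg bm_intB//; exact: bm_splice2. Qed.

Lemma avg_free B k g s : bounded_measurable g -> free_of B k ->
  E B (fun t => k t * g t) s = k s * E B g s.
Proof.
move=> bg kB; rewrite /avg -bm_intZ; last exact: bm_splice2.
by apply: eq_Rintegral => t _; rewrite kB.
Qed.

Lemma avgZ B c g s : bounded_measurable g ->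
  E B (fun t => c * g t) s = c * E B g s.
Proof. by move=> bg; rewrite avg_free. Qed.

Lemma avg_cst B c s : E B (fun=> c) s = c.
Proof. exact: bm_int_cst. Qed.

Lemma avg_id B g s : free_of B g -> E B g s = g s.
Proof.
move=> gB; rewrite -[RHS](avg_cst B (g s) s).
by apply: eq_Rintegral => t _; rewrite gB.
Qed.

Lemma avg0 g s : E finset.set0 g s = g s.
Proof. by rewrite avg_id// => u t; rewrite splice0. Qed.

Lemma avgT g s : E [set: 'I_N]%SET g s = \int[Q]_t g t.
Proof. by apply: eq_Rintegral => t _; rewrite spliceT. Qed.

Lemma avg_sum B (I : Type) (r : seq I) (p : pred I) (g : I -> N.-tuple S -> R) s :
  (forall i, p i -> bounded_measurable (g i)) ->
  E B (fun t => \sum_(i <- r | p i) g i t) s = \sum_(i <- r | p i) E B (g i) s.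
Proof.
by move=> bg; rewrite /avg bm_int_sum// => i pi; apply: bm_splice2; exact: bg.
Qed.

Lemma le_avg B g h s : bounded_measurable g -> bounded_measurable h ->
  (forall t, g t <= h t) -> E B g s <= E B h s.
Proof. by move=> bg bh gh; apply: le_bm_int => //; exact: bm_splice2. Qed.

Lemma avg_le_cst B g c s : bounded_measurable g ->
  (forall t, g t <= c) -> E B g s <= c.
Proof.
move=> bg gc; rewrite -[leRHS](avg_cst B c s).
by apply: le_avg => //; exact: bounded_measurable_cst.
Qed.

Lemma free_of_avg A B g : A \subset B -> free_of A (E B g).
Proof.
by move=> AB s t; apply: eq_Rintegral => u _; rewrite splice_id.
Qed.

Lemma free_of_avgW A B g : free_of A g -> free_of A (E B g).
Proof.
move=> gA s t; apply: eq_Rintegral => u _.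
have gAB : free_of (A :\: B)%SET g by apply: free_of_sub gA; exact: finset.subsetDl.
rewrite -[RHS](gAB _ t); congr (g _).
apply: eq_from_tnth => i; rewrite !tnth_splice !inE.
by case: (i \in A); case: (i \in B).
Qed.

Hypothesis Qind : independent_coordinates Q.

(** Tower property. Only independence enters; [A] and [B] may overlap. *)
Lemma avg_avg A B g s : bounded_measurable g ->
  E A (E B g) s = E (A :|: B)%SET g s.
Proof.
move=> bg; rewrite /avg -(Qind B (bm_splice2 (A :|: B)%SET s bg)).
by apply: eq_Rintegral => t _; apply: eq_Rintegral => u _; rewrite splice_splice.
Qed.

Lemma avgC A B g s : bounded_measurable g -> E A (E B g) s = E B (E A g) s.
Proof. by move=> bg; rewrite !avg_avg// finset.setUC. Qed.

(** The average of a product of functions, each depending on a single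
    coordinate among those in [B], factorizes. *)
Lemma avg_prod B (g : 'I_N -> N.-tuple S -> R) s :
  (forall i, i \in B -> bounded_measurable (g i)) ->
  (forall i, i \in B -> free_of (B :\ i)%SET (g i)) ->
  E B (fun t => \prod_(i in B) g i t) s = \prod_(i in B) E [set i]%SET (g i) s.
Proof.
elim/finset_ind: B s => [|i B iB ih] s bg gB.
  rewrite big_set0 -[RHS](avg_cst finset.set0 1 s).
  by congr (E _ _ _); apply/funext => t; rewrite big_set0.
have bgB j : j \in B -> bounded_measurable (g j).
  by move=> jB; apply: bg; rewrite !inE jB orbT.
have bgi : bounded_measurable (g i) by apply: bg; rewrite !inE eqxx.
have bP : bounded_measurable (fun t => \prod_(j in B) g j t).
  exact: bounded_measurable_prod.
have gi : free_of B (g i).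
  by have := gB i; rewrite setU1K//; apply; rewrite !inE eqxx.
have gBi : free_of [set i]%SET (fun t => \prod_(j in B) g j t).
  move=> u t; apply: eq_bigr => j jB.
  apply: (@free_of_sub _ _ _ _ ((i |: B) :\ j)%SET).
    by rewrite finset.sub1set !inE eqxx andbT; apply: contraNN iB => /eqP ->.
  by apply: gB; rewrite !inE jB orbT.
have -> : (fun t => \prod_(j in i |: B) g j t) =
    (fun t => (\prod_(j in B) g j t) * g i t).
  by apply/funext => t; rewrite big_setU1//= mulrC.
rewrite finset.setUC -avg_avg; last exact: bounded_measurableM.
have -> : E [set i]%SET (fun t => \prod_(j in B) g j t * g i t) =
    (fun t => E [set i]%SET (g i) t * \prod_(j in B) g j t).
  by apply/funext => t; rewrite avg_free// mulrC.
rewrite avg_free//; last exact: free_of_avgW.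
rewrite finset.setUC big_setU1//= ih// => j jB.
apply: (@free_of_sub _ _ _ _ ((i |: B) :\ j)%SET).
  by apply: finset.setSD; exact: finset.subsetUr.
by apply: gB; rewrite !inE jB orbT.
Qed.

End average.

(** * Exponential moments of mean-zero functions *)

Lemma expR_le_addr_expR2 (R : realType) (x : R) : expR x <= x + expR (2 * x ^+ 2).
Proof.
have [x2|x2] := leP x (2^-1); last first.
  apply: (@le_trans _ _ (expR (2 * x ^+ 2))); last by rewrite lerDr; lra.
  by rewrite ler_expR; nra.
apply: (@le_trans _ _ (1 + x + 2 * x ^+ 2)); last first.
  by have := expR_ge1Dx (2 * x ^+ 2); lra.
(* exp x = (exp (x/2))^2 <= (1 - x/2)^-2 since exp (-x/2) >= 1 - x/2 *)
have h : 1 - x / 2 <= expR (- (x / 2)) by have := expR_ge1Dx (- (x / 2)); lra.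
have h0 : 0 < 1 - x / 2 by lra.
have -> : expR x = (expR (- (x / 2)) ^+ 2)^-1.
  by rewrite -expRM_natl -expRN; congr expR; rewrite mulr_natl; lra.
have e0 : 0 < expR (- (x / 2)) ^+ 2 by rewrite exprn_gt0// expR_gt0.
rewrite -[_^-1]mul1r ler_pdivrMr//.
apply: (@le_trans _ _ ((1 + x + 2 * x ^+ 2) * (1 - x / 2) ^+ 2)).
  have -> : (1 + x + 2 * x ^+ 2) * (1 - x / 2) ^+ 2 =
    1 + x ^+ 2 * (5 / 4 - 7 / 4 * x + x ^+ 2 / 2) by field.
  by rewrite lerDl mulr_ge0 ?sqr_ge0//; nra.
by rewrite ler_wpM2l; [| nra | rewrite lerXn2r ?nnegrE ?expR_ge0// ltW].
Qed.

Section mean_zero.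
Context d (T : measurableType d) (R : realType) (P : probability T R).
Implicit Types h : T -> R.

Lemma int_expR_mean0 h : bounded_measurable h -> \int[P]_t h t = 0 ->
  \int[P]_t expR (h t) <= \int[P]_t expR (2 * h t ^+ 2).
Proof.
move=> bh h0.
have be : bounded_measurable (fun t => expR (2 * h t ^+ 2)).
  by apply/bounded_measurable_expR/bounded_measurableZ; exact: bounded_measurableX.
rewrite -[leRHS]add0r -h0 -bm_intD//; apply: le_bm_int.
- exact: bounded_measurable_expR.
- exact: bounded_measurableD.
- by move=> t; exact: expR_le_addr_expR2.
Qed.

(** One step of the induction behind the sub-Gaussian bound below: the
    coefficient [eta] of the square grows by [8 eta^2 b^2] when a function
    within [b] of its mean [x] is replaced by that mean. *)
Lemma int_expR_sqr_step h (x b eta : R) : bounded_measurable h ->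
  \int[P]_t h t = x -> (forall t, `|h t - x| <= b) -> 0 <= eta ->
  \int[P]_t expR (eta * h t ^+ 2) <=
  expR ((eta + 8 * eta ^+ 2 * b ^+ 2) * x ^+ 2 + eta * b ^+ 2).
Proof.
move=> bh hx hb eta0.
have bd : bounded_measurable (fun t => h t - x).
  by apply: bounded_measurableB => //; exact: bounded_measurable_cst.
pose u t := 2 * eta * x * (h t - x).
have bu : bounded_measurable u by exact: bounded_measurableZ.
have sqb t : (h t - x) ^+ 2 <= b ^+ 2.
  by rewrite -[leLHS]real_normK ?num_real// lerXn2r ?nnegrE// (le_trans _ (hb t)).
have u0 : \int[P]_t u t = 0.
  rewrite bm_intZ// bm_intB//; last exact: bounded_measurable_cst.
  by rewrite bm_int_cst hx subrr mulr0.
have := int_expR_mean0 bu u0.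
have : \int[P]_t expR (2 * u t ^+ 2) <= expR (8 * eta ^+ 2 * b ^+ 2 * x ^+ 2).
  rewrite -[leRHS](bm_int_cst P); apply: le_bm_int.
  - by apply/bounded_measurable_expR/bounded_measurableZ; exact: bounded_measurableX.
  - exact: bounded_measurable_cst.
  move=> t; rewrite ler_expR.
  have -> : 2 * u t ^+ 2 = 8 * eta ^+ 2 * x ^+ 2 * (h t - x) ^+ 2 by rewrite /u; ring.
  rewrite [leRHS]mulrAC; apply: ler_wpM2l; last exact: sqb.
  by rewrite mulr_ge0 ?sqr_ge0// mulr_ge0// sqr_ge0.
move=> h1 h2.
apply: (@le_trans _ _ (expR (eta * x ^+ 2 + eta * b ^+ 2) * \int[P]_t expR (u t))).
  rewrite -bm_intZ; last exact: bounded_measurable_expR.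
  apply: le_bm_int.
  - by apply/bounded_measurable_expR/bounded_measurableZ; exact: bounded_measurableX.
  - by apply: bounded_measurableZ; exact: bounded_measurable_expR.
  move=> t; rewrite -expRD ler_expR.
  have -> : eta * h t ^+ 2 = eta * x ^+ 2 + eta * (h t - x) ^+ 2 + u t.
    by rewrite /u; ring.
  by rewrite lerD2r lerD2l ler_wpM2l.
have -> : (eta + 8 * eta ^+ 2 * b ^+ 2) * x ^+ 2 + eta * b ^+ 2 =
   eta * x ^+ 2 + eta * b ^+ 2 + 8 * eta ^+ 2 * b ^+ 2 * x ^+ 2 by ring.
rewrite [leRHS]expRD ler_wpM2l ?expR_ge0//; exact: le_trans h2 h1.
Qed.

End mean_zero.

(** * Concentration for sums of weakly dependent functions *)

(** Changing the [i]-th coordinate changes [g] by at most [b]. *)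
Definition coord_diff_le (S : Type) (R : realType) (N : nat) (i : 'I_N) (b : R)
    (g : N.-tuple S -> R) : Prop :=
  forall s t, `|g (splice [set i]%SET s t) - g s| <= b.

Section concentration.
Context d (S : measurableType d) (R : realType) (N : nat).
Variable Q : probability (N.-tuple S) R.
Hypothesis Qind : independent_coordinates Q.
Implicit Types (A B : {set 'I_N}) (g h k q : N.-tuple S -> R) (s t : N.-tuple S).
Local Notation E := (avg Q).

Lemma coord_diff_le_avg i b A g : bounded_measurable g -> i \notin A ->
  coord_diff_le i b g -> coord_diff_le i b (E A g).
Proof.
move=> bg iA gi s t; rewrite /avg -bm_intB; try exact: bm_splice2.
apply: bm_int_bound; first by apply: bounded_measurableB; exact: bm_splice2.
move=> u; rewrite (_ : splice A (splice [set i]%SET s t) u =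
    splice [set i]%SET (splice A s u) t); first exact: gi.
apply: eq_from_tnth => j; rewrite !tnth_splice !inE.
by case: eqP => // ->; rewrite (negbTE iA).
Qed.

(** Functions with bounded differences are sub-Gaussian around their mean: the
    induction averages one coordinate at a time and lets the coefficient [eta]
    of the square grow linearly in the number of coordinates. *)
Lemma avg_expR_sqr A q (b eta : R) s : bounded_measurable q ->
  (forall i, i \in A -> coord_diff_le i b q) ->
  0 <= eta -> 32 * #|A|%:R * eta * b ^+ 2 <= 1 ->
  E A (fun t => expR (eta * q t ^+ 2)) s <=
  expR ((eta + 32 * #|A|%:R * eta ^+ 2 * b ^+ 2) * E A q s ^+ 2
        + 2 * #|A|%:R * eta * b ^+ 2).
Proof.
move=> bq + eta0.
elim/finset_ind: A s => [|i A iA ih] s qA hA.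
  rewrite cards0 !avg0 ?mulr0 ?mul0r ?addr0//.
have cA : #|(i |: A)%SET|%:R = #|A|%:R + 1 :> R.
  by rewrite cardsU1 iA add1n -natr1.
move: hA; rewrite cA => hA.
set m : R := #|A|%:R in hA ih *.
have m0 : 0 <= m by rewrite /m.
have qA' j : j \in A -> coord_diff_le j b q.
  by move=> jA; apply: qA; rewrite !inE jA orbT.
have eb0 : 0 <= eta * b ^+ 2 by rewrite mulr_ge0 ?sqr_ge0.
have hA' : 32 * m * eta * b ^+ 2 <= 1 by nra.
pose em := eta + 32 * m * eta ^+ 2 * b ^+ 2.
have em0 : eta <= em by rewrite /em lerDl -mulrA -exprMn mulr_ge0 ?sqr_ge0// mulr_ge0.
have em2 : em <= 2 * eta.
  have -> : em = eta + (32 * m * eta * b ^+ 2) * eta by rewrite /em; ring.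
  have -> : 2 * eta = eta + 1 * eta by ring.
  by rewrite lerD2l ler_wpM2r.
have bexp : bounded_measurable (fun t => expR (eta * q t ^+ 2)).
  by apply/bounded_measurable_expR/bounded_measurableZ; exact: bounded_measurableX.
have bEq : bounded_measurable (E A q) by exact: bm_avg.
have bexpE : bounded_measurable (fun t => expR (em * E A q t ^+ 2)).
  by apply/bounded_measurable_expR/bounded_measurableZ; exact: bounded_measurableX.
rewrite -!avg_avg//.
apply: (@le_trans _ _
    (E [set i]%SET (fun t => expR (2 * m * eta * b ^+ 2) * expR (em * E A q t ^+ 2)) s)).
  apply: le_avg; [exact: bm_avg|exact: bounded_measurableZ|].
  by move=> t; rewrite -expRD addrC; exact: ih.
rewrite avgZ//.
have dEq t : `|E A q (splice [set i]%SET s t) - E [set i]%SET (E A q) s| <= b.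
  rewrite -(avg_cst Q [set i]%SET (E A q (splice [set i]%SET s t)) s).
  rewrite /avg -bm_intB; [|exact: bounded_measurable_cst|exact: (bm_splice2 _ _ bEq)].
  apply: bm_int_bound.
    apply: bounded_measurableB; first exact: bounded_measurable_cst.
    exact: (bm_splice2 _ _ bEq).
  move=> u; rewrite -/(E A q _) -/(E A q _).
  rewrite -(@splice_id _ _ [set i]%SET [set i]%SET s u t)//.
  apply: coord_diff_le_avg => //.
  by apply: qA; rewrite !inE eqxx.
have := @int_expR_sqr_step _ _ _ Q (fun t => E A q (splice [set i]%SET s t)) _ b em
  (bm_splice2 _ _ bEq) erefl dEq (le_trans eta0 em0).
rewrite -/(E [set i]%SET (E A q) s) => step.
apply: le_trans.
  by apply: ler_wpM2l step; exact: expR_ge0.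
rewrite -expRD ler_expR.
set x := E _ _ _.
have x0 : 0 <= x ^+ 2 by exact: sqr_ge0.
have b0 : 0 <= b ^+ 2 by exact: sqr_ge0.
have emsq : em ^+ 2 <= 4 * eta ^+ 2.
  have -> : 4 * eta ^+ 2 = (2 * eta) ^+ 2 by ring.
  by rewrite lerXn2r ?nnegrE ?mulr_ge0// (le_trans eta0).
have -> : (eta + 32 * (m + 1) * eta ^+ 2 * b ^+ 2) * x ^+ 2 +
    2 * (m + 1) * eta * b ^+ 2 =
    em * x ^+ 2 + (8 * (4 * eta ^+ 2)) * b ^+ 2 * x ^+ 2 + 2 * m * eta * b ^+ 2 +
    2 * eta * b ^+ 2 by rewrite /em; ring.
have -> : 2 * m * eta * b ^+ 2 + ((em + 8 * em ^+ 2 * b ^+ 2) * x ^+ 2 + em * b ^+ 2) =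
    em * x ^+ 2 + (8 * em ^+ 2) * b ^+ 2 * x ^+ 2 + 2 * m * eta * b ^+ 2 + em * b ^+ 2.
  by ring.
apply: lerD; last by rewrite ler_wpM2r.
rewrite lerD2r lerD2l !ler_wpM2r//.
by rewrite ler_pM2l.
Qed.

(** A sum of mean-zero functions, each depending on its own coordinate among
    those in [B]: the exponential moment factorizes. *)
Lemma avg_expR_sum_mean0 B (q : 'I_N -> N.-tuple S -> R) s :
  (forall i, i \in B -> bounded_measurable (q i)) ->
  (forall i, i \in B -> free_of (B :\ i)%SET (q i)) ->
  (forall i t, i \in B -> E [set i]%SET (q i) t = 0) ->
  E B (fun t => expR (\sum_(i in B) q i t)) s <=
  E B (fun t => expR (\sum_(i in B) 2 * q i t ^+ 2)) s.
Proof.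
move=> bq qB q0.
have bq2 i : i \in B -> bounded_measurable (fun t => 2 * q i t ^+ 2).
  by move=> iB; apply/bounded_measurableZ/bounded_measurableX; exact: bq.
have -> : (fun t => expR (\sum_(i in B) q i t)) =
    (fun t => \prod_(i in B) expR (q i t)).
  by apply/funext => t; rewrite expR_sum.
have -> : (fun t => expR (\sum_(i in B) 2 * q i t ^+ 2)) =
    (fun t => \prod_(i in B) expR (2 * q i t ^+ 2)).
  by apply/funext => t; rewrite expR_sum.
rewrite !avg_prod//.
- apply: ler_prod => i iB; apply/andP; split.
    rewrite -(avg_cst Q [set i]%SET 0 s); apply: le_avg.
    + exact: bounded_measurable_cst.
    + by apply: bounded_measurable_expR; exact: bq.
    + by move=> t; exact: expR_ge0.
  apply: int_expR_mean0; first by apply: bm_splice2; exact: bq.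
  exact: q0.
- by move=> i iB; apply/bounded_measurable_expR; exact: bq2.
- by move=> i iB u t; rewrite qB.
- by move=> i iB; apply/bounded_measurable_expR; exact: bq.
- by move=> i iB u t; rewrite qB.
Qed.

End concentration.

Lemma jensen_expR (R : realType) (I : Type) (r : seq I) (p : pred I)
    (w y : I -> R) : (forall i, p i -> 0 <= w i) ->
  \sum_(i <- r | p i) w i = 1 ->
  expR (\sum_(i <- r | p i) w i * y i) <= \sum_(i <- r | p i) w i * expR (y i).
Proof.
move=> w0 w1; set a := \sum_(i <- r | p i) w i * y i.
(* the graph of exp lies above its tangent at the barycentre *)
have -> : expR a = \sum_(i <- r | p i) w i * (expR a * (1 + (y i - a))).
  under eq_bigr do rewrite mulrCA.
  rewrite -mulr_sumr -[LHS]mulr1; congr (_ * _).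
  under eq_bigr do rewrite addrA mulrBr mulrDr mulr1.
  by rewrite sumrB big_split/= -mulr_suml w1 -/a; ring.
apply: ler_sum => i pi; apply: ler_wpM2l; first exact: w0.
have -> : expR (y i) = expR a * expR (y i - a) by rewrite -expRD addrC subrK.
by rewrite ler_wpM2l ?expR_ge0// expR_ge1Dx.
Qed.

Section concentration_sum.
Context d (S : measurableType d) (R : realType) (N : nat).
Variable Q : probability (N.-tuple S) R.
Hypothesis Qind : independent_coordinates Q.
Implicit Types (A B : {set 'I_N}) (s t : N.-tuple S).
Local Notation E := (avg Q).

(** Triangle inequality for the Orlicz norm of the function [exp]. *)
Lemma avg_expR_add A (X Y : N.-tuple S -> R) (a b c : R) s :
  bounded_measurable X -> bounded_measurable Y -> 0 < a -> 0 < b ->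
  E A (fun t => expR (`|X t| / a)) s <= c ->
  E A (fun t => expR (`|Y t| / b)) s <= c ->
  E A (fun t => expR (`|X t + Y t| / (a + b))) s <= c.
Proof.
move=> bX bY a0 b0 hX hY.
have bm (Z : N.-tuple S -> R) z : bounded_measurable Z ->
    bounded_measurable (fun t => expR (`|Z t| / z)).
  move=> bZ; apply: bounded_measurable_expR; apply: bounded_measurableM.
    exact: bounded_measurable_norm.
  exact: bounded_measurable_cst.
have ab0 : 0 < a + b by rewrite addr_gt0.
apply: (@le_trans _ _ (E A (fun t => a / (a + b) * expR (`|X t| / a) +
    b / (a + b) * expR (`|Y t| / b)) s)).
  apply: le_avg.
  - by apply: bm; exact: bounded_measurableD.
  - by apply: bounded_measurableD; apply: bounded_measurableZ; exact: bm.
  move=> t.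
  have := @jensen_expR R bool [:: true; false] xpredT
    (fun i => (if i then a else b) / (a + b))
    (fun i => if i then `|X t| / a else `|Y t| / b).
  rewrite !big_cons !big_nil !addr0 => J.
  apply: le_trans (J _ _); last 2 first.
  - by case=> _; rewrite divr_ge0// ltW.
  - by rewrite -mulrDl divff// gt_eqF.
  rewrite ler_expR.
  have -> : a / (a + b) * (`|X t| / a) + b / (a + b) * (`|Y t| / b) =
      (`|X t| + `|Y t|) / (a + b) by field; rewrite !gt_eqF.
  by rewrite ler_pM2r ?invr_gt0// ler_normD.
rewrite avgD; [|by apply: bounded_measurableZ; exact: bm..].
rewrite !avgZ; [|exact: bm..].
have -> : c = a / (a + b) * c + b / (a + b) * c.
  by field; rewrite gt_eqF.
by apply: lerD; apply: ler_wpM2l => //; rewrite divr_ge0// ltW.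
Qed.

Lemma avg_expR_norm A (X : N.-tuple S -> R) (a c : R) s : bounded_measurable X ->
  (forall e : bool, E A (fun t => expR ((-1) ^+ e * X t / a)) s <= c) ->
  E A (fun t => expR (`|X t| / a)) s <= 2 * c.
Proof.
move=> bX hX.
have bm (Z : N.-tuple S -> R) : bounded_measurable Z ->
    bounded_measurable (fun t => expR (Z t / a)).
  move=> bZ; apply: bounded_measurable_expR; apply: bounded_measurableM => //.
  exact: bounded_measurable_cst.
apply: (@le_trans _ _ (E A (fun t => expR ((-1) ^+ false * X t / a) +
    expR ((-1) ^+ true * X t / a)) s)).
  apply: le_avg; first by apply: bm; exact: bounded_measurable_norm.
    by apply: bounded_measurableD; apply: bm; exact: bounded_measurableZ.
  move=> t; rewrite expr0 expr1 mul1r mulN1r.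
  by case: (ger0P (X t)) => _; rewrite ?lerDl ?lerDr expR_ge0.
rewrite avgD; [|by apply: bm; exact: bounded_measurableZ..].
by rewrite mulr2n mulrDl mul1r lerD.
Qed.

(** For functions of their own coordinate in [B1] and of the coordinates in
    [B2], the fluctuation due to [B2]: given [B2] the terms are independent, and
    each is sub-Gaussian as a function of [B2]. *)
Lemma avg_expR_two_blocks B1 B2 (q : 'I_N -> N.-tuple S -> R) (m b : R) s :
  (forall i, i \in B1 -> i \notin B2) ->
  #|B1|%:R <= m -> #|B2|%:R <= m -> 0 < m -> 0 < b ->
  (forall i, i \in B1 -> bounded_measurable (q i)) ->
  (forall i, i \in B1 -> free_of (B1 :\ i)%SET (q i)) ->
  (forall i t, i \in B1 -> E [set i]%SET (q i) t = 0) ->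
  (forall i t, i \in B1 -> E B2 (q i) t = 0) ->
  (forall i j, i \in B1 -> j \in B2 -> coord_diff_le j b (q i)) ->
  E (B1 :|: B2)%SET (fun t => expR (`|\sum_(i in B1) q i t| / (8 * m * b))) s
    <= 2 * expR 1.
Proof.
move=> B12 hB1 hB2 m0 b0 bq qB q0 q02 qb.
have [->|B1n0] := eqVneq B1 finset.set0.
  have -> : (fun t => expR (`|\sum_(i in (finset.set0 : {set 'I_N})) q i t| / (8 * m * b)))
      = (fun=> 1).
    by apply/funext => t; rewrite big_set0 normr0 mul0r expR0.
  by rewrite avg_cst; have := expR_ge1Dx (1 : R); lra.
have n0 : 0 < #|B1|%:R :> R by rewrite ltr0n card_gt0.
set n : R := #|B1|%:R in hB1 n0.
pose v := 8 * m * b.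
have v0 : 0 < v by rewrite /v !mulr_gt0.
have bsum : bounded_measurable (fun t => \sum_(i in B1) q i t).
  exact: bounded_measurable_sum.
apply: avg_expR_norm => // e.
pose p i t := (-1) ^+ e * q i t / v.
have pE i t : p i t = ((-1) ^+ e / v) * q i t by rewrite /p; ring.
have bp i : i \in B1 -> bounded_measurable (p i).
  move=> iB; have -> : p i = fun t => ((-1) ^+ e / v) * q i t by apply/funext => t.
  by apply: bounded_measurableZ; exact: bq.
have -> : (fun t => expR ((-1) ^+ e * (\sum_(i in B1) q i t) / (8 * m * b))) =
    (fun t => expR (\sum_(i in B1) p i t)).
  by apply/funext => t; rewrite mulr_sumr mulr_suml.
have psq i t : p i t ^+ 2 = q i t ^+ 2 / v ^+ 2.
  by rewrite /p 2!exprMn exprVn sqrr_sign mul1r.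
pose eta := 2 * n / v ^+ 2.
have eta0 : 0 <= eta by rewrite /eta divr_ge0 ?sqr_ge0// mulr_ge0// ltW.
have bs : bounded_measurable (fun t => expR (\sum_(i in B1) p i t)).
  by apply: bounded_measurable_expR; exact: bounded_measurable_sum.
have bs2 : bounded_measurable (fun t => expR (\sum_(i in B1) 2 * p i t ^+ 2)).
  apply: bounded_measurable_expR; apply: bounded_measurable_sum => i iB.
  by apply/bounded_measurableZ/bounded_measurableX; exact: bp.
have be i : i \in B1 -> bounded_measurable (fun t => expR (eta * q i t ^+ 2)).
  move=> iB; apply/bounded_measurable_expR/bounded_measurableZ/bounded_measurableX.
  exact: bq.
rewrite finset.setUC -avg_avg//.
apply: (@le_trans _ _ (E B2 (E B1 (fun t => expR (\sum_(i in B1) 2 * p i t ^+ 2))) s)).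
  apply: le_avg; [exact: bm_avg|exact: bm_avg|] => t.
  apply: avg_expR_sum_mean0 => //.
  - by move=> i iB u w; rewrite !pE qB.
  - move=> i u iB; have -> : p i = fun t => ((-1) ^+ e / v) * q i t by apply/funext.
    by rewrite avgZ ?q0 ?mulr0//; exact: bq.
rewrite avg_avg//.
apply: (@le_trans _ _ (E (B2 :|: B1)%SET
    (fun t => n^-1 * \sum_(i in B1) expR (eta * q i t ^+ 2)) s)).
  apply: le_avg => //; first by apply: bounded_measurableZ; exact: bounded_measurable_sum.
  move=> t; rewrite mulr_sumr.
  have := @jensen_expR R _ (index_enum 'I_N) (mem B1) (fun=> n^-1)
    (fun i => eta * q i t ^+ 2).
  rewrite (_ : \sum_(i in B1) n^-1 * (eta * q i t ^+ 2) =
    \sum_(i in B1) 2 * p i t ^+ 2); last first.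
    apply: eq_bigr => i _; rewrite psq /eta; field.
    by rewrite gt_eqF// gt_eqF.
  apply; first by move=> i _; rewrite invr_ge0 ltW.
  by rewrite sumr_const -mulr_natr mulVf// gt_eqF.
rewrite avgZ; last exact: bounded_measurable_sum.
rewrite avg_sum// ler_pdivrMl//.
have -> : n * expR 1 = \sum_(i in B1) expR (1 : R).
  by rewrite sumr_const mulr_natl.
apply: ler_sum => i iB.
rewrite finset.setUC -avg_avg; [|by []|exact: be].
apply: avg_le_cst; first by apply: bm_avg; exact: be.
move=> t.
have hyp : 32 * #|B2|%:R * eta * b ^+ 2 <= 1.
  rewrite /eta /v.
  have -> : 32 * #|B2|%:R * (2 * n / (8 * m * b) ^+ 2) * b ^+ 2 =
    (#|B2|%:R * n) / (m * m) by field; rewrite !gt_eqF.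
  by rewrite ler_pdivrMr ?mul1r ?mulr_gt0// ler_pM// ltW.
apply: le_trans (avg_expR_sqr Qind _ (bq i iB) _ eta0 hyp) _.
  by move=> j jB; exact: qb.
rewrite ler_expR q02// expr0n/= mulr0 add0r; move: hyp.
by set x := _%:R; lra.
Qed.

Lemma subset_half (A : {set 'I_N}) n : (#|A| <= n + n)%N ->
  exists B1 B2 : {set 'I_N}, [/\ A = (B1 :|: B2)%SET,
    forall i, i \in B1 -> i \notin B2, (#|B1| <= n)%N & (#|B2| <= n)%N].
Proof.
move=> An; pose B1 := [set x in take n (enum A)]%SET.
exists B1, (A :\: B1)%SET.
have B1A : B1 \subset A.
  by apply/fintype.subsetP => i; rewrite inE => /mem_take; rewrite mem_enum.
have uB1 : #|B1| = minn n #|A|.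
  by rewrite cardsE (card_uniqP _) ?take_uniq ?enum_uniq// size_take_min -cardE.
split.
- apply/setP => i; rewrite !inE.
  by move/fintype.subsetP: B1A => /(_ i); rewrite inE; case: (i \in take _ _) => //= ->.
- by move=> i iB1; rewrite inE iB1.
- by rewrite uB1 geq_minl.
- by rewrite cardsDS// uB1 leq_subLR; move: An; rewrite /minn; case: ltnP => //; lia.
Qed.

Variables (b : R) (g : 'I_N -> N.-tuple S -> R).
Hypotheses (b0 : 0 < b) (bg : forall i, bounded_measurable (g i)).
Hypothesis g0 : forall i s, E [set i]%SET (g i) s = 0.
Hypothesis gb : forall i j, i != j -> coord_diff_le j b (g i).

Lemma avg_mean0 A i s : E [set i]%SET (E A (g i)) s = 0.
Proof.
rewrite avgC//; have -> : E [set i]%SET (g i) = fun=> 0 by apply/funext.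
exact: avg_cst.
Qed.

(** Deviation of the sum from the sum of its projections on single coordinates.
    Halving the block [B = B1 :|: B2] leaves two deviations of the same kind,
    over [B1] and over [B2], and two sums controlled by
    [avg_expR_two_blocks]; the bound doubles at each of the [k] levels, up to
    the contribution of that level. *)
Lemma avg_expR_sum_deviation k B s : (#|B| <= 2 ^ k)%N ->
  E B (fun t => expR (`|\sum_(i in B) (g i t - E (B :\ i)%SET (g i) t)| /
                      (8 * k.+1%:R * 2 ^+ k * b))) s <= 2 * expR 1.
Proof.
elim: k B s => [|k ih] B s hB.
  rewrite (_ : (fun t => _) = (fun=> 1)).
    by rewrite avg_cst; have := expR_ge1Dx (1 : R); lra.
  apply/funext => t; rewrite big1 ?normr0 ?mul0r ?expR0// => i iB.
  rewrite (_ : (B :\ i)%SET = finset.set0) ?avg0 ?subrr//.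
  by apply/eqP; rewrite -cards_eq0; move: hB; rewrite (cardsD1 i) iB; lia.
have [|B1 [B2 [eB B12 hB1 hB2]]] := @subset_half B (2 ^ k).
  by move: hB; rewrite expnS; lia.
have B21 i : i \in B2 -> i \notin B1.
  by move=> iB2; apply/negP => /B12; rewrite iB2.
pose W A t := \sum_(i in A) (g i t - E (A :\ i)%SET (g i) t).
pose U A t := \sum_(i in A) (E (A :\ i)%SET (g i) t - E (B :\ i)%SET (g i) t).
have bE i A : bounded_measurable (E A (g i)) by exact: bm_avg.
have bW A : bounded_measurable (W A).
  by apply: bounded_measurable_sum => i _; exact: bounded_measurableB.
have bU A : bounded_measurable (U A).
  by apply: bounded_measurable_sum => i _; exact: bounded_measurableB.
have sumE t : \sum_(i in B) (g i t - E (B :\ i)%SET (g i) t) =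
    (W B1 t + W B2 t) + (U B1 t + U B2 t).
  have sB (F : 'I_N -> R) :
      \sum_(i in B) F i = \sum_(i in B1) F i + \sum_(i in B2) F i.
    rewrite (bigID (mem B1))/=; congr (_ + _); apply: eq_bigl => i; rewrite eB !inE.
      by case: (i \in B1); rewrite ?andbF.
    move: (B12 i); case: (i \in B1) => /= [h|_]; last by rewrite andbT.
    by rewrite (negbTE (h isT)).
  rewrite sB addrACA /W /U -!big_split/=.
  by congr (_ + _); apply: eq_bigr => i _; rewrite addrA subrK.
set tk : R := 8 * k.+1%:R * 2 ^+ k * b.
set v : R := 8 * 2 ^+ k * b.
have tk0 : 0 < tk by rewrite /tk !mulr_gt0 ?ltr0n// exprn_gt0.
have v0 : 0 < v by rewrite /v !mulr_gt0// exprn_gt0.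
have -> : 8 * k.+2%:R * 2 ^+ k.+1 * b = (tk + tk) + (v + v).
  by rewrite /tk /v exprS -(natr1 k.+1); ring.
under eq_fun do rewrite sumE.
have norm_bm (Z : N.-tuple S -> R) z : bounded_measurable Z ->
    bounded_measurable (fun t => expR (`|Z t| / z)).
  move=> bZ; apply: bounded_measurable_expR; apply: bounded_measurableM.
    exact: bounded_measurable_norm.
  exact: bounded_measurable_cst.
have hW A A' : B = (A' :|: A)%SET -> (#|A| <= 2 ^ k)%N ->
    E B (fun t => expR (`|W A t| / tk)) s <= 2 * expR 1.
  move=> eBA hA; rewrite eBA -avg_avg//; last exact: norm_bm.
  by apply: avg_le_cst; [exact/bm_avg/norm_bm|move=> t; exact: ih].
have hU A A' : B = (A :|: A')%SET -> (forall i, i \in A -> i \notin A') ->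
    (#|A| <= 2 ^ k)%N -> (#|A'| <= 2 ^ k)%N ->
    E B (fun t => expR (`|U A t| / v)) s <= 2 * expR 1.
  move=> eBA AA' hA hA'; rewrite eBA.
  have kE i t : i \in A -> E (B :\ i)%SET (g i) t = E A' (E (A :\ i)%SET (g i)) t.
    move=> iA; rewrite avg_avg//; congr (avg Q _ (g i) t).
    rewrite eBA; apply/setP => j; rewrite !inE.
    case: eqVneq => [->|_] /=; last by rewrite orbC.
    by rewrite (negbTE (AA' _ iA)).
  apply: avg_expR_two_blocks => //.
  - by rewrite -natrX ler_nat.
  - by rewrite -natrX ler_nat.
  - by move=> i iA; exact: bounded_measurableB.
  - move=> i iA u t; congr (_ - _).
      exact: free_of_avg.
    rewrite (kE i (splice _ _ _) iA) (kE i u iA).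
    by apply: free_of_avgW; exact: free_of_avg.
  - by move=> i t iA; rewrite avgB// !avg_mean0 subrr.
  - move=> i t iA; rewrite avgB//.
    have -> : E (B :\ i)%SET (g i) = E A' (E (A :\ i)%SET (g i)).
      by apply/funext => u; rewrite kE.
    by rewrite [X in _ - X]avg_avg// finset.setUid subrr.
  - move=> i j iA jA' u t.
    have ij : i != j by apply/eqP => ij; move: (AA' i iA); rewrite ij jA'.
    have jB : [set j]%SET \subset (B :\ i)%SET.
      by rewrite finset.sub1set eBA !inE eq_sym ij jA' orbT.
    rewrite (free_of_avg Q (g i) jB).
    set x := E _ _ _; set y := E _ _ _; set z := E _ _ _.
    have -> : x - y - (z - y) = x - z by ring.
    apply: coord_diff_le_avg => //.
      by rewrite !inE negb_and (_ : j \notin A) ?orbT//; apply/negP => /AA'; rewrite jA'.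
    exact: gb.
apply: avg_expR_add; rewrite ?addr_gt0//; try exact: bounded_measurableD.
  by apply: avg_expR_add => //; [apply: (hW B1 B2); rewrite // finset.setUC|exact: (hW B2 B1)].
by apply: avg_expR_add => //; [exact: (hU B1 B2)|apply: (hU B2 B1); rewrite // finset.setUC].
Qed.

(** Moment bound of Bousquet, Klochkov and Zhivotovskiy for a sum of [N]
    functions, the [i]-th of which is centred in the [i]-th coordinate and
    insensitive to each of the others. The projections on single coordinates,
    bounded by [kappa], are independent and contribute the Gaussian term [w]. *)
Lemma int_expR_weakly_dependent_sum (k : nat) (kappa w : R) :
  (N <= 2 ^ k)%N -> 0 < w -> 2 * N%:R * kappa ^+ 2 <= w ^+ 2 ->
  (forall i s, `|E (~: [set i])%SET (g i) s| <= kappa) ->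
  \int[Q]_t expR (`|\sum_i g i t| / (8 * k.+1%:R * 2 ^+ k * b + w))
    <= 2 * expR 1.
Proof.
move=> Nk w0 hw hk.
have [s _] : exists s : N.-tuple S, True.
  apply: contrapT => noS.
  have : Q setT = 1%E by exact: probability_setT.
  rewrite (_ : setT = set0) ?measure0; first by move=> /esym/eqP; rewrite onee_eq0.
  by apply/seteqP; split => // u _; apply: noS; exists u.
pose K i := E (~: [set i])%SET (g i).
have bK i : bounded_measurable (K i) by exact: bm_avg.
rewrite -(avgT Q _ s).
under eq_fun => t.
  rewrite (_ : \sum_i g i t = \sum_i (g i t - K i t) + \sum_i K i t); last first.
    by rewrite -big_split/=; apply: eq_bigr => i _; rewrite subrK.
  over.
apply: avg_expR_add => //.
- by apply: bounded_measurable_sum => i _; exact: bounded_measurableB.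
- exact: bounded_measurable_sum.
- by rewrite !mulr_gt0 ?ltr0n// exprn_gt0.
- have sumT t : \sum_i (g i t - K i t) =
      \sum_(i in [set: 'I_N]%SET) (g i t - E ([set: 'I_N] :\ i)%SET (g i) t).
    by apply: eq_big => i; [rewrite inE|move=> _; rewrite /K -finset.setTD].
  under eq_fun do rewrite sumT.
  by apply: avg_expR_sum_deviation; rewrite cardsT card_ord.
apply: avg_expR_norm => [|e]; first exact: bounded_measurable_sum.
pose p i t := (-1) ^+ e * K i t / w.
have pE i : p i = fun t => ((-1) ^+ e / w) * K i t.
  by apply/funext => t; rewrite /p; ring.
have bp i : bounded_measurable (p i) by rewrite pE; exact: bounded_measurableZ.
have -> : (fun t => expR ((-1) ^+ e * (\sum_i K i t) / w)) =
    (fun t => expR (\sum_(i in [set: 'I_N]%SET) p i t)).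
  apply/funext => t; rewrite mulr_sumr mulr_suml; congr expR.
  by apply: eq_bigl => i; rewrite inE.
apply: le_trans.
  apply: avg_expR_sum_mean0 => //.
  - move=> i _ u t; rewrite !pE; congr (_ * _); apply: free_of_avg.
    by rewrite finset.setTD.
  - by move=> i t _; rewrite pE avgZ// avg_mean0 mulr0.
apply: avg_le_cst.
  apply: bounded_measurable_expR; apply: bounded_measurable_sum => i _.
  by apply/bounded_measurableZ/bounded_measurableX.
move=> t; rewrite ler_expR.
apply: (@le_trans _ _ (\sum_(i in [set: 'I_N]%SET) 2 * (kappa ^+ 2 / w ^+ 2))).
  apply: ler_sum => i _; rewrite ler_pM2l//.
  rewrite /p !exprMn exprVn sqrr_sign mul1r ler_pM2r ?invr_gt0 ?exprn_gt0//.
  rewrite -[leLHS]real_normK ?num_real// lerXn2r ?nnegrE//; last exact: hk.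
  by rewrite (le_trans _ (hk i t)).
rewrite sumr_const cardsT card_ord -[leLHS]mulr_natl.
have -> : N%:R * (2 * (kappa ^+ 2 / w ^+ 2)) = (2 * N%:R * kappa ^+ 2) / w ^+ 2.
  by ring.
by rewrite ler_pdivrMr ?exprn_gt0// mul1r.
Qed.

End concentration_sum.

(** * The law of an independent sample *)

Lemma bm_int_distribution d d' (T : measurableType d) (T' : measurableType d')
    (R : realType) (P : probability T R) (X : {RV P >-> T'}) (g : T' -> R) :
  bounded_measurable g ->
  \int[distribution P X]_y g y = \int[P]_w g (X w).
Proof.
move=> bg; rewrite /Rintegral (@integral_distribution _ _ _ _ _ P X (EFin \o g))//.
  by apply/measurable_EFinP; case: bg.
by apply: bounded_measurable_integrable (bounded_measurable_comp _ bg).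
Qed.

Section sample_law.
Context (dO dS : measure_display) (Omega : measurableType dO)
  (S : measurableType dS) (R : realType) (P : probability Omega R)
  (N : nat) (Y : 'I_N -> {RV P >-> S}).

Lemma measurable_sample : measurable_fun setT (sample Y).
Proof.
apply/measurable_fun_tnthP => i.
rewrite (_ : _ \o _ = Y i); first exact: measurable_funP.
by apply/funext => w /=; rewrite tnth_mktuple.
Qed.

HB.instance Definition _ := isMeasurableFun.Build _ _ _ _ (sample Y) measurable_sample.

(** The sample as a random variable. *)
Definition sampleRV : {RV P >-> N.-tuple S} := [the {mfun _ >-> _} of sample Y].

(** The measurable rectangles, a pi-system generating the product
    sigma-algebra. *)
Definition rectangle (A : 'I_N -> set S) : set (N.-tuple S) :=
  [set s | forall i, A i (tnth s i)].

Definition rectangles : set (set (N.-tuple S)) :=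
  [set rectangle A | A in [set A | forall i, measurable (A i)]].

Lemma rectangle_bigcap A :
  rectangle A = \bigcap_(i in [set: 'I_N]) ((fun s => tnth s i) @^-1` A i).
Proof. by apply/seteqP; split=> s /= h i; [move=> _; exact: h|exact: h i I]. Qed.

Lemma measurable_rectangle A : (forall i, measurable (A i)) ->
  measurable (rectangle A).
Proof.
move=> mA; rewrite rectangle_bigcap; apply: fin_bigcap_measurable => // i _.
by rewrite -[X in measurable X]setTI; exact: measurable_tnth.
Qed.

Lemma rectangles_generate : measurable = <<s rectangles >>.
Proof.
apply/seteqP; split; last first.
  apply: smallest_sub; first exact: sigma_algebra_measurable.
  by move=> _ [A mA <-]; exact: measurable_rectangle.
apply: smallest_sub; first exact: smallest_sigma_algebra.
rewrite -bigcup_seq => _ [i _ [A mA <-]].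
apply: sub_sigma_algebra; exists (fun j => if j == i then A else setT).
  by move=> j; case: ifP.
rewrite setTI; apply/seteqP; split => s /=.
  by move=> /(_ i); rewrite eqxx.
by move=> As j; case: eqP => // ->.
Qed.

Lemma rectanglesI : setI_closed rectangles.
Proof.
move=> _ _ [A mA <-] [B mB <-]; exists (fun i => A i `&` B i).
  by move=> i; exact: measurableI.
apply/seteqP; split => s /=.
  by move=> AB; split => i; have [] := AB i.
by move=> [As Bs] i.
Qed.

Hypothesis indY : mutually_independent P Y.
Local Notation Q := (distribution P sampleRV).

Lemma sample_rectangle A : (forall i, measurable (A i)) ->
  Q (rectangle A) = (\prod_i P (Y i @^-1` A i))%E.
Proof.
move=> mA; have := indY [set: 'I_N]%SET mA.
rewrite (eq_bigl xpredT) => [<-|i]; last by rewrite inE.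
congr (P _); apply/seteqP; split => w /=.
  by move=> h i _; have := h i; rewrite tnth_mktuple.
by move=> h i; rewrite tnth_mktuple; apply: h; rewrite /= inE.
Qed.

(** The image of the product law of two independent samples under [splice B]
    agrees with the law of the sample on rectangles, hence everywhere. *)
Lemma sample_independent_coordinates : independent_coordinates Q.
Proof.
move=> B g bg.
pose QQ := [the probability _ _ of (Q \x Q)%E].
pose u : {mfun (N.-tuple S * N.-tuple S)%type >-> N.-tuple S} :=
  mfun_Sub (mem_set (@measurable_splice _ S N B)).

have uQ A : measurable A -> distribution QQ u A = Q A.
  move=> mA.
  apply: (measure_unique rectangles (fun=> setT) rectangles_generate rectanglesI
    _ _ (distribution QQ u) Q _ _ A mA) => //.
  - by move=> _; exists (fun=> setT) => //; apply/seteqP; split.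
  - by apply/seteqP; split => // s _; exists 0%N.
  - move=> _ [C mC <-].
    pose C1 i := if i \in B then setT else C i.
    pose C2 i := if i \in B then C i else setT.
    have mC1 i : measurable (C1 i) by rewrite /C1; case: ifP.
    have mC2 i : measurable (C2 i) by rewrite /C2; case: ifP.
    transitivity ((Q \x Q)%E (rectangle C1 `*` rectangle C2)).
      rewrite /distribution /pushforward; congr ((Q \x Q)%E _).
      apply/seteqP; split => -[s t] /=.
        move=> h; split => i /=; have := h i; rewrite tnth_splice /C1 /C2;
        by case: ifP.
      move=> [h1 h2] i; rewrite tnth_splice.
      by have := h1 i; have := h2 i; rewrite /C1 /C2; case: ifP.
    rewrite product_measure1E; try exact: measurable_rectangle.
    rewrite [LHS]/= [X in (X * _)%E]sample_rectangle// [X in (_ * X)%E]sample_rectangle//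
      [RHS]sample_rectangle// -big_split/=; apply: eq_bigr => i _.
    rewrite /C1 /C2; case: ifP => _; rewrite preimage_setT probability_setT.
      by rewrite mul1e.
    by rewrite mule1.
  - by move=> _; rewrite [X in (X < _)%E](@probability_setT _ _ _ (distribution QQ u)) ltry.
transitivity (\int[distribution QQ u]_s g s).
  rewrite bm_int_distribution// (bm_int_prod Q Q)//.
  exact: (bounded_measurable_comp (@measurable_splice _ S N B)).
by rewrite /Rintegral; congr fine; apply: eq_measure_integral => A mA _; exact: uQ.
Qed.

Lemma int_coordinate (xi : {RV P >-> S}) i (g : S -> R) : same_law P (Y i) xi ->
  bounded_measurable g -> \int[Q]_t g (tnth t i) = \int[P]_w g (xi w).
Proof.
move=> law bg.
have bgi : bounded_measurable (fun t : N.-tuple S => g (tnth t i)).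
  exact: (bounded_measurable_comp (@measurable_tnth _ S N i)).
rewrite (bm_int_distribution sampleRV bgi).
transitivity (\int[P]_w g (Y i w)).
  by apply: eq_Rintegral => w _ /=; rewrite tnth_mktuple.
rewrite -!bm_int_distribution// /Rintegral; congr fine.
by apply: eq_measure_integral => A mA _; exact: law.
Qed.

End sample_law.
(** * Stability of approximate empirical minimizers *)

Lemma lp_norm_ge0 (R : realType) d (p : \bar R) (x : 'rV[R]_d) :
  0 <= lp_norm p x.
Proof.
case: p => [r| |] //=; first exact: powR_ge0.
by elim/big_ind: _ => // a b a0 b0; rewrite le_max a0.
Qed.

(** [x] is a point of [X] minimizing [G] over [X] up to [e]. *)
Definition approx_minimizer (R : realType) (T : Type) (X : set T) (G : T -> R)
    (e : R) (x : T) : Prop :=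
  X x /\ forall y, X y -> G x <= G y + e.

Section stability.
Context (R : realType) (d : nat) (p : \bar R) (S : Type) (N : nat).
Variables (mu M : R) (X : set 'rV[R]_d) (f : 'rV[R]_d -> S -> R).
Implicit Types (s t : N.-tuple S) (x y : 'rV[R]_d).
Local Notation Fhat := (@empirical_objective S R d N f).

Hypotheses (N0 : (0 < N)%N) (mu0 : 0 < mu) (M0 : 0 < M).
Hypothesis lip : forall x y z, X x -> X y ->
  `|f y z - f x z| <= M * lp_norm p (y - x).
Hypothesis growth : forall s, quadratic_growth p mu X (Fhat s).

(* distance by which the solution set moves when one observation changes *)
Let r := 4 * M / (mu * N%:R).

Let NR0 : 0 < N%:R :> R. Proof. by rewrite ltr0n. Qed.

Lemma exists_close_solution s x : X x -> exists2 x', solutions X (Fhat s) x' &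
  mu / 2 * lp_norm p (x - x') ^+ 2 <= Fhat s x - Fhat s x'.
Proof.
move=> Xx; have [[x' px'] gr] := growth s Xx.
by exists x'; [case: px'|exact: gr].
Qed.

Lemma approx_minimizer_near_solution s e x :
  0 <= e -> approx_minimizer X (Fhat s) e x ->
  exists2 x', solutions X (Fhat s) x' &
    forall z, `|f x z - f x' z| <= M * Num.sqrt (2 * e / mu).
Proof.
move=> e0 [Xx xe]; have [x' sx' gr] := exists_close_solution s Xx.
have [Xx' _] := sx'.
exists x' => // z; apply: le_trans (lip z Xx' Xx) _.
rewrite ler_pM2l// -[leLHS](ger0_norm (lp_norm_ge0 _ _)) -sqrtr_sqr ler_sqrt; last first.
  by rewrite divr_ge0 ?mulr_ge0// ltW.
have := xe _ Xx'; rewrite ler_pdivlMr//; move: gr; set D := _ ^+ 2; lra.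
Qed.

Lemma empirical_objective_swap s t i x y :
  (forall j, j != i -> tnth t j = tnth s j) ->
  N%:R * (Fhat t x - Fhat t y) =
  N%:R * (Fhat s x - Fhat s y) + (f x (tnth t i) - f y (tnth t i))
                               - (f x (tnth s i) - f y (tnth s i)).
Proof.
move=> st; rewrite /empirical_objective -!mulrBr !mulrA mulfV ?gt_eqF// !mul1r.
rewrite -!sumrB (bigD1 i)//= [in RHS](bigD1 i)//=.
rewrite (eq_bigr (fun j => f x (tnth s j) - f y (tnth s j))); first by ring.
by move=> j ji; rewrite st.
Qed.

(** A minimizer for [s] is close to a minimizer for any sample [t] differing
    from [s] at the [i]-th observation only. *)
Lemma solution_swap s t i x : (forall j, j != i -> tnth t j = tnth s j) ->
  solutions X (Fhat s) x -> exists2 y, solutions X (Fhat t) y &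
    lp_norm p (x - y) <= r /\ N%:R * (Fhat t x - Fhat t y) <= 2 * M * r.
Proof.
move=> st [Xx xmin]; have [y sy gr] := exists_close_solution t Xx.
exists y => //; have [Xy ymin] := sy.
set D := lp_norm p (x - y) in gr *.
have D0 : 0 <= D by exact: lp_norm_ge0.
have step : N%:R * (Fhat t x - Fhat t y) <= 2 * M * D.
  rewrite (empirical_objective_swap _ _ st).
  have := lip (tnth t i) Xy Xx; have := lip (tnth s i) Xy Xx.
  rewrite -/D !ler_norml => /andP[h1 _] /andP[_ h2].
  have : N%:R * (Fhat s x - Fhat s y) <= 0.
    by rewrite pmulr_rle0// subr_le0 xmin.
  lra.
have Dr : D <= r.
  have [->|Dn0] := eqVneq D 0; first by rewrite /r divr_ge0// ?mulr_ge0// ltW.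
  have Dp : 0 < D by rewrite lt_def Dn0.
  rewrite /r ler_pdivlMr ?mulr_gt0// -(ler_pM2r Dp).
  have : N%:R * (mu / 2 * D ^+ 2) <= 2 * M * D.
    by apply: le_trans step; rewrite ler_pM2l.
  by rewrite expr2; lra.
split => //; apply: le_trans step _.
by rewrite ler_pM2l// mulr_gt0.
Qed.

(** All the losses are almost constant on the set of empirical minimizers: each
    of its points remains almost optimal when one observation is replaced by
    [z], and averaging over the replaced observation isolates [f _ z]. *)
Lemma solutions_flat s x y z : solutions X (Fhat s) x -> solutions X (Fhat s) y ->
  `|f x z - f y z| <= 2 * M * r.
Proof.
move=> sx sy.
wlog suff : x y sx sy / f x z - f y z <= 2 * M * r.
  move=> h; rewrite ler_norml h// andbT lerNl opprB; exact: h.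
have [[Xx xmin] [Xy ymin]] := (sx, sy).
have FE : Fhat s x = Fhat s y by apply/eqP; rewrite eq_le xmin//= ymin.
have swap j : (f x z - f y z) - (f x (tnth s j) - f y (tnth s j)) <= 2 * M * r.
  pose t := [tuple if k == j then z else tnth s k | k < N].
  have tE k : k != j -> tnth t k = tnth s k.
    by move=> kj; rewrite tnth_mktuple (negbTE kj).
  have tj : tnth t j = z by rewrite tnth_mktuple eqxx.
  have [x' [Xx' x'min] [_]] := solution_swap tE sx.
  have := empirical_objective_swap x y tE; rewrite FE subrr mulr0 add0r tj => <-.
  apply: le_trans; rewrite ler_pM2l// lerD2l lerN2; exact: x'min.
have : \sum_(j < N) ((f x z - f y z) - (f x (tnth s j) - f y (tnth s j))) <=
    \sum_(j < N) (2 * M * r) by apply: ler_sum => j _; exact: swap.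
rewrite sumrB !sumr_const !card_ord -(mulr_natl (f x z - f y z)) -(mulr_natl (2 * M * r)).
have -> : \sum_(j < N) (f x (tnth s j) - f y (tnth s j)) = 0.
  have : N%:R * (Fhat s x - Fhat s y) = 0 by rewrite FE subrr mulr0.
  rewrite /empirical_objective -mulrBr mulrA mulfV ?gt_eqF// mul1r => FN.
  by rewrite sumrB FN.
by rewrite subr0 ler_pM2l.
Qed.

(** The role of the variance condition in fast rates is played by this pointwise
    bound, used with [y] a minimizer of the expected objective and [e2] its
    empirical suboptimality. *)
Lemma approx_minimizers_flat s x y z e1 e2 : 0 <= e1 -> 0 <= e2 ->
  approx_minimizer X (Fhat s) e1 x -> approx_minimizer X (Fhat s) e2 y ->
  `|f x z - f y z| <=
  M * Num.sqrt (2 * e1 / mu) + 2 * M * r + M * Num.sqrt (2 * e2 / mu).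
Proof.
move=> e10 e20 /(approx_minimizer_near_solution e10)[x' sx' /(_ z) hx].
move=> /(approx_minimizer_near_solution e20)[y' sy' /(_ z) hy].
have := solutions_flat z sx' sy'.
move: hx hy; rewrite !ler_norml => /andP[? ?] /andP[? ?] /andP[? ?].
by apply/andP; split; lra.
Qed.

(** Uniform stability: the loss at an approximate minimizer hardly depends on
    any single observation. *)
Lemma approx_minimizer_stable s t i x y z e : 0 <= e ->
  (forall j, j != i -> tnth t j = tnth s j) ->
  approx_minimizer X (Fhat s) e x -> approx_minimizer X (Fhat t) e y ->
  `|f x z - f y z| <= 3 * M * r + 2 * M * Num.sqrt (2 * e / mu).
Proof.
move=> e0 st /(approx_minimizer_near_solution e0)[x' sx' /(_ z) hx].
move=> /(approx_minimizer_near_solution e0)[y' sy' /(_ z) hy].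
have [u su [hu _]] := solution_swap st sx'.
have := solutions_flat z su sy'.
have [[Xx' _] [Xu _]] := (sx', su).
have : `|f x' z - f u z| <= M * r.
  by apply: le_trans (lip z Xu Xx') _; rewrite ler_pM2l.
move: hx hy; rewrite !ler_norml.
move=> /andP[? ?] /andP[? ?] /andP[? ?] /andP[? ?].
by apply/andP; split; lra.
Qed.

(** The growth condition for a sample with all observations equal to [z] is a
    growth condition for [f _ z], which bounds its oscillation. *)
Lemma loss_oscillation x y z : X x -> X y ->
  `|f x z - f y z| <= 2 * M ^+ 2 / mu.
Proof.
move=> Xx Xy.
wlog suff : x y Xx Xy / f x z - f y z <= 2 * M ^+ 2 / mu.
  move=> h; rewrite ler_norml h// andbT lerNl opprB; exact: h.
pose s := [tuple z | _ < N].
have FE u : Fhat s u = f u z.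
  rewrite /empirical_objective (eq_bigr (fun=> f u z)) => [|k _].
    by rewrite sumr_const card_ord -[X in _ * X]mulr_natl mulrA mulVf ?mul1r ?gt_eqF.
  by rewrite tnth_mktuple.
have [x' [Xx' x'min]] := exists_close_solution s Xx.
have := x'min _ Xy; rewrite !FE => hy gr.
have := lip z Xx' Xx; rewrite ler_norml => /andP[_].
move: gr; set D := lp_norm p (x - x') => gr hD.
have D0 : 0 <= D by exact: lp_norm_ge0.
apply: (@le_trans _ _ (M * D)); first by lra.
have [->|Dn0] := eqVneq D 0; first by rewrite mulr0 divr_ge0 ?mulr_ge0 ?sqr_ge0// ltW.
have Dp : 0 < D by rewrite lt_def Dn0.
have : D <= 2 * M / mu.
  rewrite ler_pdivlMr// -(ler_pM2r Dp).
  have : mu / 2 * D ^+ 2 <= M * D by apply: le_trans hD.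
  by rewrite expr2; lra.
rewrite -(ler_pM2l M0) => /le_trans; apply.
by rewrite le_eqVlt; apply/orP; left; apply/eqP; field; rewrite gt_eqF.
Qed.

End stability.

(** * Measurable selection of approximate minimizers *)

Lemma lp_norm_le_coord (R : realType) d (p : \bar R) (x : 'rV[R]_d) (c : R) :
  (1 <= p)%E -> 0 <= c -> (forall i, `|x 0 i| <= c) -> lp_norm p x <= d%:R * c.
Proof.
move=> p1 c0 xc; have [d0|d0] := posnP d.
  subst d; case: p p1 => [r| |] //= p1; rewrite ?big_ord0 ?mul0r//.
  by rewrite powR0// invr_neq0// gt_eqF// (lt_le_trans ltr01).
have d1 : 1 <= d%:R :> R by rewrite ler1n.
case: p p1 => [r| |] //= p1; last first.
  apply: (@le_trans _ _ c); last by rewrite ler_peMl.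
  by elim/big_ind: _ => // a b ac bc; rewrite ge_max ac.
have r1 : 1 <= r by rewrite -lee_fin.
have r0 : 0 < r by apply: lt_le_trans r1.
have rn0 : r != 0 by rewrite gt_eqF.
have ri0 : 0 <= r^-1 by rewrite invr_ge0 ltW.
have s0 : 0 <= \sum_(i < d) `|x 0 i| `^ r by apply: sumr_ge0 => i _; exact: powR_ge0.
have s1 : \sum_(i < d) `|x 0 i| `^ r <= d%:R * c `^ r.
  have -> : d%:R * c `^ r = \sum_(i < d) c `^ r.
    by rewrite sumr_const card_ord mulr_natl.
  by apply: ler_sum => i _; rewrite ge0_ler_powR ?nnegrE// ltW.
apply: le_trans.
  apply: (ge0_ler_powR ri0 _ _ s1); rewrite nnegrE// mulr_ge0 ?powR_ge0//.
rewrite powRM ?powR_ge0// -powRrM divff// powRr1// ler_wpM2r//.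
by rewrite ler1_powR// invf_le1.
Qed.

(** A sequence of points of [X] that is dense in [X], coordinatewise: one point
    of [X] in every nonempty cell of every grid of mesh [1 / (k + 1)]. *)
Lemma exists_dense_sequence (R : realType) d (X : set 'rV[R]_d) : X !=set0 ->
  exists u : nat -> 'rV[R]_d, (forall n, X (u n)) /\
    forall x k, X x -> exists n, forall i, `|u n 0 i - x 0 i| <= k.+1%:R^-1.
Proof.
move=> [x0 Xx0].
pose cell (c : nat * {ffun 'I_d -> int}) : set 'rV[R]_d :=
  [set y | X y /\ forall i, Num.floor (y 0 i * c.1.+1%:R) = c.2 i].
pose u n := if unpickle n is Some c then xget x0 (cell c) else x0.
exists u; split=> [n|x k Xx].
  by rewrite /u; case: unpickle => // c; case: xgetP => // y _ [].
pose c : nat * {ffun 'I_d -> int} := (k, [ffun i => Num.floor (x 0 i * k.+1%:R)]).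
exists (pickle c) => i; rewrite /u pickleK.
have [_ /(_ i)] : cell c (xget x0 (cell c)).
  by apply: (@xgetPex _ x0 (cell c)); exists x; split => // j; rewrite ffunE.
set y := xget _ _ => /=; rewrite ffunE => fE.
have k0 : 0 < k.+1%:R :> R by rewrite ltr0n.
have := floor_le (y 0 i * k.+1%:R); have := floorD1_gt (y 0 i * k.+1%:R).
have := floor_le (x 0 i * k.+1%:R); have := floorD1_gt (x 0 i * k.+1%:R).
rewrite fE intrD; set fl := _%:~R => h1 h2 h3 h4.
rewrite -(ler_pM2r k0) mulVf ?gt_eqF// -[k.+1%:R in leLHS]gtr0_norm// -normrM.
by rewrite mulrBl ler_norml; apply/andP; split; lra.
Qed.

Section countable_selection.
Context d (T : measurableType d).

(** The first index [n] such that [A n t]. *)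
Lemma exists_measurable_index (A : nat -> set T) :
  (forall n, measurable (A n)) -> (forall t, exists n, A n t) ->
  exists idx : T -> nat, (forall t, A (idx t) t) /\
    forall n, measurable [set t | idx t = n].
Proof.
move=> mA exA.
have exA' t : exists n, `[< A n t >] by have [n An] := exA t; exists n; apply/asboolP.
exists (fun t => ex_minn (exA' t)); split=> [t|n].
  by case: ex_minnP => n /asboolP.
rewrite (_ : [set _ | _] = A n `&` \bigcap_(m in [set m | (m < n)%N]) ~` A m).
  apply: measurableI => //; apply: bigcap_measurableType => m _.
  exact: measurableC.
apply/seteqP; split => t /=.
  case: ex_minnP => m /asboolP Am min <-; split => // j jm Aj.
  by have := min j; rewrite leqNgt jm => /(_ (asboolT Aj)).
move=> [An nA]; case: ex_minnP => m /asboolP Am min.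
apply/eqP; rewrite eqn_leq min; last exact/asboolP.
by rewrite leqNgt; apply/negP => mn; exact: (nA m mn).
Qed.

Lemma measurable_fun_index d' (T' : measurableType d') (idx : T -> nat)
    (phi : nat -> T -> T') :
  (forall n, measurable [set t | idx t = n]) ->
  (forall n, measurable_fun setT (phi n)) ->
  measurable_fun setT (fun t => phi (idx t) t).
Proof.
move=> mi mphi _ Y mY; rewrite setTI.
rewrite (_ : _ @^-1` _ = \bigcup_n ([set t | idx t = n] `&` phi n @^-1` Y)).
  apply: bigcup_measurable => n _; apply: measurableI => //.
  by rewrite -[X in measurable X]setTI; exact: mphi.
apply/seteqP; split => t /=.
  by move=> h; exists (idx t).
by move=> [n _ [<-]].
Qed.

End countable_selection.

Section lipschitz_family.
Context d (T : measurableType d) (R : realType) (n : nat).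
Variables (p : \bar R) (M : R) (X : set 'rV[R]_n) (phi : 'rV[R]_n -> T -> R).
Hypotheses (p1 : (1 <= p)%E) (M0 : 0 < M) (X0 : X !=set0).
Hypothesis mphi : forall x, X x -> measurable_fun setT (phi x).
Hypothesis lip : forall x y t, X x -> X y ->
  `|phi y t - phi x t| <= M * lp_norm p (y - x).

Lemma lipschitz_family_coord x y t k : X x -> X y ->
  (forall i, `|y 0 i - x 0 i| <= k.+1%:R^-1) ->
  `|phi y t - phi x t| <= M * n%:R / k.+1%:R.
Proof.
move=> Xx Xy xy; apply: le_trans (lip t Xx Xy) _.
rewrite -mulrA ler_pM2l//; apply: lp_norm_le_coord => // i.
by rewrite !mxE.
Qed.

(** A family that is measurable in [t] and Lipschitz in [x] can be evaluated at
    a measurable point [v t]: approximate [v t] by points of a dense sequence. *)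
Lemma measurable_fun_lipschitz_family (v : T -> 'rV[R]_n) :
  (forall t, X (v t)) -> (forall i, measurable_fun setT (fun t => v t 0 i)) ->
  measurable_fun setT (fun t => phi (v t) t).
Proof.
move=> Xv mv; have [u [Xu du]] := exists_dense_sequence X0.
have idxk k : exists idx : T -> nat,
    (forall t i, `|u (idx t) 0 i - v t 0 i| <= k.+1%:R^-1) /\
    forall m, measurable [set t | idx t = m].
  apply: (exists_measurable_index
    (A := fun m => [set t | forall i, `|u m 0 i - v t 0 i| <= k.+1%:R^-1])).
    move=> m.
    rewrite (_ : [set _ | _] =
        \bigcap_(i in [set: 'I_n]) [set t | `|u m 0 i - v t 0 i| <= k.+1%:R^-1]).
      apply: fin_bigcap_measurable => // i _.
      rewrite -[X in measurable X]setTI -preimage_true.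
      apply: measurable_fun_ler => //; apply: measurableT_comp => //.
      exact: measurable_funB.
    by apply/seteqP; split => t /= h i; [move=> _; exact: h|exact: h i I].
  by move=> t; exact: du.
have [idx hidx] := choice idxk.
apply: (@measurable_fun_cvg _ _ _ _ (fun k t => phi (u (idx k t)) t)).
  move=> k; apply: (measurable_fun_index (phi := fun m => phi (u m))) => [|m].
    exact: (hidx k).2.
  exact/mphi/Xu.
move=> t _; apply/cvgrPdist_le => /= e e0.
near=> k; rewrite distrC.
apply: le_trans (lipschitz_family_coord (k := k) t (Xv t) (Xu _) _) _.
  by move=> i; exact: (hidx k).1.
rewrite ler_pdivrMr// -ler_pdivrMl//.
near: k; apply: filterS (nbhs_infty_ger (e^-1 * (M * n%:R))) => k /= /le_trans; apply.
by rewrite ler_nat.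
Unshelve. all: by end_near. Qed.

Hypothesis attained : forall t, exists x, solutions X (phi^~ t) x.

Lemma minimum_solution t x : solutions X (phi^~ t) x -> minimum X (phi^~ t) = phi x t.
Proof.
move=> [Xx xmin]; apply/eqP; rewrite eq_le; apply/andP; split.
  by apply: ge_inf; [exists (phi x t) => _ [y Xy <-]; exact: xmin|exists x].
apply: lb_le_inf; first by exists (phi x t), x.
by move=> _ [y Xy <-]; exact: xmin.
Qed.

Lemma dense_approx_minimizer (u : nat -> 'rV[R]_n) t e : 0 < e -> (forall k, X (u k)) ->
  (forall x k, X x -> exists m, forall i, `|u m 0 i - x 0 i| <= k.+1%:R^-1) ->
  exists m, phi (u m) t <= minimum X (phi^~ t) + e.
Proof.
move=> e0 Xu du; have [x sx] := attained t.
have [Xx _] := sx.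
pose k := Num.bound (M * n%:R / e).
have [m um] := du x k Xx.
exists m; rewrite (minimum_solution sx) -lerBlDl.
apply: le_trans (ler_norm _) _.
apply: le_trans (lipschitz_family_coord t Xx (Xu m) um) _.
rewrite ler_pdivrMr// [e * _]mulrC -ler_pdivrMr//.
apply: (@le_trans _ _ k%:R); last by rewrite ler_nat.
by rewrite ltW// /k archi_boundP// divr_ge0 ?mulr_ge0// ltW.
Qed.

Lemma measurable_fun_minimum :
  measurable_fun setT (fun t => minimum X (phi^~ t)).
Proof.
have [u [Xu du]] := exists_dense_sequence X0.
move=> mT; apply: (measurability _ (RGenInftyO.measurableE R)) => //.
move=> _ [_ [c ->] <-]; rewrite setTI.
rewrite (_ : _ @^-1` _ = \bigcup_m (phi (u m) @^-1` `]-oo, c[%classic)).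
  apply: bigcup_measurable => m _; rewrite -[X in measurable X]setTI.
  by apply: mphi => //; exact: measurable_itv.
apply/seteqP; split => t /=; rewrite in_itv/=.
  move=> mc.
  have e0 : 0 < (c - minimum X (phi^~ t)) / 2 by rewrite divr_gt0// subr_gt0.
  have [m hm] := dense_approx_minimizer t e0 Xu du.
  by exists m => //=; rewrite in_itv/=; lra.
move=> [m _] /=; rewrite in_itv/=; apply: le_lt_trans.
by have [x sx] := attained t; rewrite (minimum_solution sx); case: sx => _; exact.
Qed.

(** A countably-valued measurable selection of [e]-minimizers. Being countably
    valued, it can be substituted into any function that is measurable for each
    fixed point. *)
Lemma exists_measurable_approx_minimizer e : 0 < e ->
  exists (u : nat -> 'rV[R]_n) (idx : T -> nat),
  [/\ forall m, X (u m), forall m, measurable [set t | idx t = m] &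
      forall t, approx_minimizer X (phi^~ t) e (u (idx t))].
Proof.
move=> e0; have [u [Xu du]] := exists_dense_sequence X0.
pose A m := [set t | phi (u m) t <= minimum X (phi^~ t) + e].
have mA m : measurable (A m).
  rewrite /A -[X in measurable X]setTI -preimage_true; apply: measurable_fun_ler => //.
    exact: mphi.
  by apply: measurable_funD => //; exact: measurable_fun_minimum.
have exA t : exists m, A m t by exact: dense_approx_minimizer.
have [idx [hidx midx]] := exists_measurable_index mA exA.
exists u, idx; split => // t; split => // y Xy.
have [x sx] := attained t.
apply: le_trans (hidx t) _; rewrite (minimum_solution sx) lerD2r.
by case: sx => _; exact.
Qed.

End lipschitz_family.

(** * Deviation of the excess risk of an approximate empirical minimizer *)

(** Markov inequality for the exponential moment of [`|Z|]. *)
Lemma exponential_markov d (T : measurableType d) (R : realType)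
    (P : probability T R) (Z : T -> R) (tau v c : R) :
  0 < tau -> bounded_measurable Z -> \int[P]_t expR (`|Z t| / tau) <= c ->
  (P [set t | (v < Z t)%R] <= (c * expR (- (v / tau)))%:E)%E.
Proof.
move=> tau0 bZ hZ; set A := [set t | v < Z t].
have mA : measurable A.
  rewrite /A -[X in measurable X]setTI -preimage_true.
  by apply: measurable_fun_ltr => //; case: bZ.
have bA : bounded_measurable (\1_A : T -> R).
  split; first exact: measurable_indic.
  by exists 1 => t; rewrite indicE; case: (t \in A); rewrite ?normr1 ?normr0.
have be : bounded_measurable (fun t => expR (`|Z t| / tau)).
  apply/bounded_measurable_expR/bounded_measurableM.
    exact: bounded_measurable_norm.
  exact: bounded_measurable_cst.
have PA : P A = (\int[P]_t (\1_A t : R))%:E.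
  rewrite /Rintegral integral_indic// setIT fineK// fin_num_measure//.
rewrite PA lee_fin; apply: (@le_trans _ _
    (\int[P]_t (expR (- (v / tau)) * expR (`|Z t| / tau)))).
  apply: le_bm_int => //; first exact: bounded_measurableZ.
  move=> t; rewrite indicE -expRD; case: (boolP (t \in A)) => [|_]; last exact: expR_ge0.
  rewrite inE /A/= => vZ; rewrite -[leLHS]expR0 ler_expR addrC subr_ge0.
  by rewrite ler_pM2r ?invr_gt0// (le_trans (ltW vZ))// ler_norm.
by rewrite bm_intZ// mulrC ler_wpM2r// expR_ge0.
Qed.

Section excess_risk.
Context (R : realType) (d : nat) (p : \bar R) (mu M : R) (X : set 'rV[R]_d)
  (dO : measure_display) (Omega : measurableType dO) (P : probability Omega R)
  (dS : measure_display) (S : measurableType dS)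
  (xi : {RV P >-> S}) (f : 'rV[R]_d -> S -> R)
  (N : nat) (xis : 'I_N -> {RV P >-> S}).
Implicit Types (s t : N.-tuple S) (i j : 'I_N).
Local Notation F := (expected_objective P xi f).
Local Notation Fhat := (fun s : N.-tuple S => empirical_objective f s).
Local Notation Q := (distribution P (sampleRV xis)).

Hypotheses (N0 : (0 < N)%N) (mu0 : 0 < mu) (M0 : 0 < M).
Hypothesis mf : forall x, X x -> measurable_fun [set: S] (f x).
Hypothesis intf : forall x, X x ->
  P.-integrable [set: Omega] (fun w => (f x (xi w))%:E).
Hypothesis lip : forall x y z, X x -> X y ->
  `|f y z - f x z| <= M * lp_norm p (y - x).
Hypothesis ind : mutually_independent P xis.
Hypothesis law : forall k, same_law P (xis k) xi.
Hypothesis growth : forall s, quadratic_growth p mu X (Fhat s).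

(* [eta] is a tolerance small enough for [eta]-minimizers to be as stable as
   exact ones, and [gamma] is the resulting stability constant *)
Let a := M ^+ 2 / mu.
Let eta := 2 * a / N%:R ^+ 2.
Let gamma := 16 * a / N%:R.

Let NR0 : 0 < N%:R :> R. Proof. by rewrite ltr0n. Qed.
Let NR1 : 1 <= N%:R :> R. Proof. by rewrite ler1n. Qed.
Let a0 : 0 < a. Proof. by rewrite /a divr_gt0// exprn_gt0. Qed.
Let eta0 : 0 < eta. Proof. by rewrite /eta divr_gt0 ?exprn_gt0// mulr_gt0. Qed.
Let gamma0 : 0 < gamma. Proof. by rewrite /gamma divr_gt0// mulr_gt0. Qed.
Let QI : independent_coordinates Q. Proof. exact: sample_independent_coordinates. Qed.

Let Mr : M * (4 * M / (mu * N%:R)) = 4 * a / N%:R.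
Proof. by rewrite /a; field; rewrite !gt_eqF. Qed.

Let sqrt_eta : M * Num.sqrt (2 * eta / mu) = 2 * a / N%:R.
Proof.
have -> : 2 * eta / mu = (2 * M / (mu * N%:R)) ^+ 2.
  by rewrite /eta /a; field; rewrite !gt_eqF.
rewrite sqrtr_sqr ger0_norm; last by rewrite divr_ge0 ?mulr_ge0// ltW.
by rewrite /a; field; rewrite !gt_eqF.
Qed.

Lemma expected_objectiveB x y : X x -> X y ->
  F x - F y = \int[P]_w (f x (xi w) - f y (xi w)).
Proof.
move=> Xx Xy; rewrite RintegralB//; [|exact: intf..].
by rewrite /expected_objective unlock.
Qed.

Lemma expected_objective_diff_le x y c : X x -> X y ->
  (forall z, `|f x z - f y z| <= c) -> `|F x - F y| <= c.
Proof.
move=> Xx Xy hc; rewrite expected_objectiveB//; apply: bm_int_bound => //.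
split; last by exists c.
by apply: measurable_funB; apply: measurableT_comp => //; exact: mf.
Qed.

Lemma empirical_objective_diff_le s x y c :
  (forall z, `|f x z - f y z| <= c) -> `|Fhat s x - Fhat s y| <= c.
Proof.
move=> hc; rewrite /empirical_objective -mulrBr -sumrB normrM ger0_norm ?invr_ge0//.
rewrite ler_pdivrMl// (le_trans (ler_norm_sum _ _ _))//.
apply: (@le_trans _ _ (\sum_(k < N) c)); first by apply: ler_sum => k _.
by rewrite sumr_const card_ord mulr_natl.
Qed.

(** [u (idx s)] is a measurable choice of an approximate minimizer. *)
Variables (u : nat -> 'rV[R]_d) (idx : N.-tuple S -> nat) (xs : 'rV[R]_d).
Hypothesis Xu : forall m, X (u m).
Hypothesis midx : forall m, measurable [set s | idx s = m].
Hypothesis hidx : forall s, approx_minimizer X (Fhat s) eta (u (idx s)).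
Hypothesis hxs : solutions X F xs.

Let x s := u (idx s).
(* excess loss and excess risk of the selected point *)
Let h s z := f (x s) z - f xs z.
Let H s := F (x s) - F xs.

Let Xxs : X xs. Proof. by case: hxs. Qed.
Let Xx s : X (x s). Proof. exact: Xu. Qed.

Let h_bound s z : `|h s z| <= 2 * M ^+ 2 / mu.
Proof. exact: (loss_oscillation N0 mu0 M0 lip growth). Qed.

Let H_bound s : `|H s| <= 2 * M ^+ 2 / mu.
Proof. by apply: expected_objective_diff_le => // z; exact: h_bound. Qed.

Let H_ge0 s : 0 <= H s.
Proof. by rewrite /H subr_ge0; case: hxs => _; apply. Qed.

Let bm_h d' (T : measurableType d') (v : T -> N.-tuple S) (z : T -> S) :
  measurable_fun setT v -> measurable_fun setT z ->
  bounded_measurable (fun w => h (v w) (z w)).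
Proof.
move=> mv mz; split; last by exists (2 * M ^+ 2 / mu) => w; exact: h_bound.
apply: (measurable_fun_index (idx := fun w => idx (v w))
    (phi := fun m w => f (u m) (z w) - f xs (z w))) => [m|m].
  by rewrite -[X in measurable X]setTI; exact: (mv _ [set s | idx s = m]).
by apply: measurable_funB; apply: measurableT_comp => //; exact: mf.
Qed.

Let bm_H : bounded_measurable H.
Proof.
split; last by exists (2 * M ^+ 2 / mu) => t; exact: H_bound.
exact: (measurable_fun_index (phi := fun m _ => F (u m) - F xs)).
Qed.

Let H_int s : H s = \int[P]_w h s (xi w).
Proof. exact: expected_objectiveB. Qed.

Let stable s t i z : (forall j, j != i -> tnth t j = tnth s j) ->
  `|f (x s) z - f (x t) z| <= gamma.
Proof.
move=> st.
apply: le_trans (approx_minimizer_stable N0 mu0 M0 lip growth z (ltW eta0) st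
  (hidx s) (hidx t)) _.
by rewrite -[3 * M * _]mulrA -[2 * M * _]mulrA Mr sqrt_eta /gamma; lra.
Qed.

Let h_stable s t i z : (forall j, j != i -> tnth t j = tnth s j) ->
  `|h s z - h t z| <= gamma.
Proof.
move=> st; rewrite (_ : h s z - h t z = f (x s) z - f (x t) z); last by rewrite /h; ring.
exact: stable st.
Qed.

Let H_stable s t i : (forall j, j != i -> tnth t j = tnth s j) ->
  `|H s - H t| <= gamma.
Proof.
move=> st; rewrite (_ : H s - H t = F (x s) - F (x t)); last by rewrite /H; ring.
by apply: expected_objective_diff_le => // z; exact: stable st.
Qed.

Variable t0 : N.-tuple S.

Let q i s := splice [set i]%SET s t0.

(* generalization error at the [i]-th observation of the minimizer trained
   with that observation replaced by the one of [t0] *)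
Let g i s := H (q i s) - h (q i s) (tnth s i).

Let q_agree i s j : j != i -> tnth (q i s) j = tnth s j.
Proof. by move=> ji; rewrite tnth_splice inE (negbTE ji). Qed.

Let mq i : measurable_fun setT (q i).
Proof. exact: measurable_splice1. Qed.

Let bm_g i : bounded_measurable (g i).
Proof.
apply: bounded_measurableB; first exact: (bounded_measurable_comp (mq i)).
by apply: bm_h => //; exact: measurable_tnth.
Qed.

Let g_mean0 i s : avg Q [set i]%SET (g i) s = 0.
Proof.
have gE t : g i (splice [set i]%SET s t) = H (q i s) - h (q i s) (tnth t i).
  by rewrite /g /q splice_id// tnth_splice inE eqxx.
have bz : bounded_measurable (fun z => h (q i s) z).
  by apply: bm_h; [exact: measurable_cst|exact: measurable_id].
have bzt : bounded_measurable (fun t : N.-tuple S => h (q i s) (tnth t i)).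
  exact: (bounded_measurable_comp (@measurable_tnth _ S N i)).
transitivity (\int[Q]_t (H (q i s) - h (q i s) (tnth t i))).
  by apply: eq_Rintegral => t _; exact: gE.
rewrite bm_intB//; last exact: bounded_measurable_cst.
by rewrite bm_int_cst (int_coordinate (law i) bz) -H_int subrr.
Qed.

Let g_diff i j : i != j -> coord_diff_le j (2 * gamma) (g i).
Proof.
move=> ij s t; rewrite /g tnth_splice inE (negbTE ij).
have st k : k != j -> tnth (q i s) k = tnth (q i (splice [set j]%SET s t)) k.
  by move=> kj; rewrite !tnth_splice !inE (negbTE kj).
have := H_stable st; have := h_stable (tnth s i) st.
rewrite !ler_norml => /andP[? ?] /andP[? ?].
by apply/andP; split; lra.
Qed.

Let g_close i s : `|g i s - (H s - h s (tnth s i))| <= 2 * gamma.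
Proof.
have st : forall j, j != i -> tnth (q i s) j = tnth s j by exact: q_agree.
have := H_stable st; have := h_stable (tnth s i) st; rewrite /g.
rewrite !ler_norml => /andP[? ?] /andP[? ?].
by apply/andP; split; lra.
Qed.

(* empirical suboptimality of [xs] *)
Let Y s := Fhat s xs - Fhat s (x s).

Let YE s : Y s = - (N%:R^-1 * \sum_i h s (tnth s i)).
Proof.
rewrite /Y /empirical_objective -mulrBr -mulrN; congr (_ * _).
by rewrite -sumrB -sumrN; apply: eq_bigr => i _; rewrite opprB.
Qed.

Let sum_close s : \sum_i (H s - h s (tnth s i)) <= \sum_i g i s + N%:R * (2 * gamma).
Proof.
have -> : N%:R * (2 * gamma) = \sum_(i < N) (2 * gamma).
  by rewrite sumr_const card_ord mulr_natl.
rewrite -big_split/=; apply: ler_sum => i _.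
by have := g_close i s; rewrite ler_norml => /andP[]; lra.
Qed.

Let sumE s : \sum_i (H s - h s (tnth s i)) = N%:R * (H s + Y s).
Proof.
rewrite sumrB sumr_const card_ord YE mulrDr mulrN mulrA mulfV ?gt_eqF// mul1r.
by rewrite [N%:R * _]mulr_natl.
Qed.

Let Y_ge s : - eta <= Y s.
Proof. by have := (hidx s).2 _ Xxs; rewrite /Y -/(x s); lra. Qed.

Let excess_le s : N%:R * H s <= \sum_i g i s + N%:R * (2 * gamma + eta).
Proof.
have := sum_close s; rewrite sumE.
have : N%:R * - eta <= N%:R * Y s by rewrite ler_pM2l.
lra.
Qed.

Let bm_Y : bounded_measurable Y.
Proof.
rewrite (_ : Y = fun s => - (N%:R^-1 * \sum_i h s (tnth s i))); last first.
  by apply/funext => s; exact: YE.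
apply/bounded_measurableN/bounded_measurableZ/bounded_measurable_sum => i _.
by apply: bm_h; [exact: measurable_id|exact: measurable_tnth].
Qed.

(* the empirical suboptimality of [xs] is of order [gamma] on average since the
   generalization errors [g i] have mean zero and the excess risk is
   nonnegative *)
Let int_Y : \int[Q]_s Y s <= 2 * gamma.
Proof.
have bs : bounded_measurable (fun s => \sum_i g i s).
  by apply: bounded_measurable_sum => i _.
apply: (@le_trans _ _ (\int[Q]_s (N%:R^-1 * (\sum_i g i s) + 2 * gamma))).
  apply: le_bm_int => //.
    apply: bounded_measurableD; first exact: bounded_measurableZ.
    exact: bounded_measurable_cst.
  move=> s; rewrite -(ler_pM2l NR0) [leRHS]mulrDr [N%:R * (N%:R^-1 * _)]mulrA.
  rewrite mulfV ?gt_eqF// mul1r.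
  have := sum_close s; rewrite sumE.
  have : 0 <= N%:R * H s by rewrite mulr_ge0.
  lra.
rewrite bm_intD; [|exact: bounded_measurableZ|exact: bounded_measurable_cst].
rewrite bm_int_cst bm_intZ// bm_int_sum// big1 ?mulr0 ?add0r// => i _.
rewrite -(avgT Q (g i) t0) -[[set: 'I_N]%SET](finset.setTU [set i]%SET).
rewrite -avg_avg//; transitivity (avg Q [set: 'I_N]%SET (fun=> 0) t0).
  by congr (avg _ _ _ _); apply/funext => s; exact: g_mean0.
exact: avg_cst.
Qed.

Let N2 := Num.sqrt (N%:R : R).
Let N2_gt0 : 0 < N2. Proof. by rewrite sqrtr_gt0. Qed.
Let N2_sq : N2 * N2 = N%:R. Proof. by rewrite -expr2 sqr_sqrtr// ltW. Qed.
Let N2_ge1 : 1 <= N2. Proof. by rewrite -sqrtr1 ler_sqrt. Qed.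

Let h_le s z : `|h s z| <= 10 * a / N%:R + N2 * (Y s + eta) + a / (2 * N2).
Proof.
have Ye : 0 <= Y s + eta by have := Y_ge s; lra.
have hxs' : approx_minimizer X (Fhat s) (Y s + eta) xs.
  split => // y Xy; have := (hidx s).2 _ Xy; rewrite /Y -/(x s); lra.
apply: le_trans (approx_minimizers_flat N0 mu0 M0 lip growth z (ltW eta0) Ye
  (hidx s) hxs') _.
rewrite -[2 * M * _]mulrA Mr sqrt_eta.
(* sqrt (2 a y) <= N^(1/2) y + a / (2 N^(1/2)) *)
have : M * Num.sqrt (2 * (Y s + eta) / mu) <= N2 * (Y s + eta) + a / (2 * N2).
  have c0 : 0 <= N2 * (Y s + eta) + a / (2 * N2).
    apply: addr_ge0; first by apply: mulr_ge0 => //; exact: ltW.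
    by apply: divr_ge0; [exact: ltW|apply: mulr_ge0 => //; exact: ltW].
  have -> : M * Num.sqrt (2 * (Y s + eta) / mu) =
      Num.sqrt (M ^+ 2 * (2 * (Y s + eta) / mu)).
    by rewrite [RHS]sqrtrM ?sqr_ge0// sqrtr_sqr gtr0_norm.
  rewrite -[X in _ <= X](ger0_norm c0) -sqrtr_sqr ler_sqrt ?sqr_ge0//.
  rewrite -subr_ge0.
  have -> : (N2 * (Y s + eta) + a / (2 * N2)) ^+ 2 - M ^+ 2 * (2 * (Y s + eta) / mu) =
     (N2 * (Y s + eta) - a / (2 * N2)) ^+ 2.
    by rewrite /a; field; rewrite !gt_eqF.
  exact: sqr_ge0.
have : 0 <= a / N%:R by rewrite divr_ge0// ltW.
lra.
Qed.

Let kappa := 122 * a / N2.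

(* the losses at [x s] and [xs] differ by a quantity of order [a / N^(1/2)] on
   average, because [xs] is almost optimal for the average sample *)
Let g_proj_le i s : `|avg Q (~: [set i]) (g i) s| <= kappa.
Proof.
pose c0 := 10 * a / N%:R + N2 * eta + a / (2 * N2) + gamma.
have gle t : `|g i (splice (~: [set i]) s t)| <= 2 * (c0 + N2 * Y t).
  rewrite /g tnth_splice !inE eqxx/=.
  have st j : j != i -> tnth (q i (splice (~: [set i]) s t)) j = tnth t j.
    by move=> ji; rewrite q_agree// tnth_splice !inE ji.
  have := h_stable (tnth s i) st; have := H_stable st; have := h_le t (tnth s i).
  have : `|H t| <= 10 * a / N%:R + N2 * (Y t + eta) + a / (2 * N2).
    by apply: expected_objective_diff_le => // z; exact: h_le.
  rewrite /c0 mulrDr !ler_norml.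
  move=> /andP[? ?] /andP[? ?] /andP[? ?] /andP[? ?].
  by apply/andP; split; lra.
have bb : bounded_measurable (fun t => 2 * (c0 + N2 * Y t)).
  apply/bounded_measurableZ/bounded_measurableD; first exact: bounded_measurable_cst.
  exact: bounded_measurableZ.
apply: (@le_trans _ _ (\int[Q]_t (2 * (c0 + N2 * Y t)))).
  apply: le_trans.
    apply: le_normr_Rintegral => //; apply: bounded_measurable_integrable.
    exact: bm_splice2.
  by apply: le_bm_int => //; apply: bounded_measurable_norm; exact: bm_splice2.
rewrite bm_intZ; last first.
  apply: bounded_measurableD; first exact: bounded_measurable_cst.
  exact: bounded_measurableZ.
rewrite bm_intD; [|exact: bounded_measurable_cst|exact: bounded_measurableZ].
rewrite bm_int_cst bm_intZ//.
apply: (@le_trans _ _ (2 * (c0 + N2 * (2 * gamma)))).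
  by rewrite ler_pM2l// lerD2l ler_pM2l//; exact: int_Y.
have invN : N%:R^-1 <= N2^-1.
  by rewrite lef_pV2 ?posrE// -N2_sq ler_peMl// ltW.
have e1 : a / N%:R <= a / N2 by rewrite ler_pM2l.
have e2 : N2 * (2 * gamma) = 32 * (a / N2) by rewrite /gamma -N2_sq; field; rewrite gt_eqF.
have e3 : N2 * eta <= 2 * (a / N2).
  have -> : N2 * eta = 2 * ((a / N2) / N%:R).
    by rewrite /eta -N2_sq; field; rewrite gt_eqF.
  rewrite ler_pM2l// ler_pdivrMr// ler_peMr// ltW// divr_gt0//.
have e4 : a / (2 * N2) = (a / N2) / 2 by field; rewrite gt_eqF.
have e5 : 0 < a / N2 by rewrite divr_gt0.
rewrite /kappa e2 /c0 e4 /gamma; lra.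
Qed.

Variable c : R.
Hypothesis c_ge : 32 ^+ 2 <= c.

Let tau := c * a * (ln N%:R + 2).

Let c0 : 0 < c. Proof. by apply: lt_le_trans c_ge; rewrite exprn_gt0. Qed.

Let lnN0 : 0 <= ln (N%:R : R). Proof. exact: ln_ge0. Qed.

Let tau0 : 0 < tau.
Proof. by rewrite /tau; apply: mulr_gt0; [exact: mulr_gt0|rewrite ltr_wpDl]. Qed.

Let int_expR_sum_g : \int[Q]_s expR (`|\sum_i g i s| / tau) <= 2 * expR 1.
Proof.
set k := (trunc_log 2 N).+1.
have Nk : (N <= 2 ^ k)%N by exact/ltnW/trunc_log_ltn.
have kN : 2 ^+ k <= 2 * N%:R :> R.
  by rewrite exprS ler_pM2l// -natrX ler_nat trunc_logP.
have w0 : 0 < 200 * a by rewrite mulr_gt0.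
have hw : 2 * N%:R * kappa ^+ 2 <= (200 * a) ^+ 2.
  have -> : 2 * N%:R * kappa ^+ 2 = 2 * 122 ^+ 2 * a ^+ 2.
    by rewrite /kappa -N2_sq; field; rewrite gt_eqF.
  by rewrite [(200 * a) ^+ 2]exprMn; apply: ler_wpM2r; [exact: sqr_ge0|lra].
have b0 : 0 < 2 * gamma by rewrite mulr_gt0.
have := @int_expR_weakly_dependent_sum _ _ _ _ _ QI _ _ b0 bm_g g_mean0 g_diff
  k kappa (200 * a) Nk w0 hw g_proj_le.
apply: le_trans; set tau' := _ + 200 * a.
have tau'0 : 0 < tau' by apply: addr_gt0 => //; apply: mulr_gt0.
have tt : tau' <= tau.
  have trl : (trunc_log 2 N)%:R <= 2 * ln N%:R :> R.
    (* N >= 2^l and 2 >= exp (1/2) *)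
    have e2 : expR (2^-1) <= 2 :> R.
      have : expR (- 2^-1) >= 2^-1 :> R by have := expR_ge1Dx (- 2^-1 : R); lra.
      by rewrite expRN lef_pV2 ?posrE ?expR_gt0.
    have : (2 : R) ^+ (trunc_log 2 N) <= N%:R by rewrite -natrX ler_nat trunc_logP.
    move=> /(le_trans (lerXn2r (trunc_log 2 N) (expR_ge0 _) (ler0n _ 2) e2)).
    rewrite -expRM_natl -(ler_ln (expR_gt0 _)) ?posrE ?expR_gt0// expRK.
    by lra.
  have e : 2 ^+ k * (2 * gamma) <= 64 * a.
    have -> : 64 * a = (2 * N%:R) * (2 * gamma) by rewrite /gamma; field; rewrite gt_eqF.
    by rewrite ler_pM2r.
  have k1 : k.+1%:R = (trunc_log 2 N)%:R + 2 :> R.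
    by rewrite /k -(natr1 (_.+1)) -(natr1 (trunc_log 2 N)); lra.
  have : 8 * k.+1%:R * (2 ^+ k * (2 * gamma)) <= 8 * k.+1%:R * (64 * a).
    by rewrite ler_wpM2l// mulr_ge0.
  have : a * (trunc_log 2 N)%:R <= a * (2 * ln N%:R) by rewrite ler_pM2l.
  have : 32 ^+ 2 * (a * (ln N%:R + 2)) <= c * (a * (ln N%:R + 2)).
    by apply: ler_wpM2r => //; apply: mulr_ge0; [exact: ltW|rewrite addr_ge0].
  rewrite /tau' /tau -[c * a * _]mulrA -[8 * _ * 2 ^+ k * _]mulrA k1; lra.
apply: le_bm_int.
- apply/bounded_measurable_expR/bounded_measurableM; last exact: bounded_measurable_cst.
  by apply/bounded_measurable_norm/bounded_measurable_sum => i _.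
- apply/bounded_measurable_expR/bounded_measurableM; last exact: bounded_measurable_cst.
  by apply/bounded_measurable_norm/bounded_measurable_sum => i _.
by move=> s; rewrite ler_expR ler_wpM2l// lef_pV2 ?posrE.
Qed.

(** Outside an event of small probability, the excess risk of the selected
    approximate minimizer is of order [a / N], up to the deviation [v]. *)
Lemma excess_risk_tail (v : R) : exists2 Z : set (N.-tuple S),
  measurable Z /\ (Q Z <= (2 * expR 1 * expR (- (v / tau)))%:E)%E &
  forall s, ~ Z s -> N%:R * (F (u (idx s)) - F xs) <= v + 34 * a.
Proof.
have bs : bounded_measurable (fun s => \sum_i g i s).
  by apply: bounded_measurable_sum => i _.
exists [set s | v < \sum_i g i s].
  split; last exact: exponential_markov.
  rewrite -[X in measurable X]setTI -preimage_true.
  by apply: measurable_fun_ltr => //; case: bs.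
move=> s /negP; rewrite -leNgt => sv; apply: le_trans (excess_le s) _.
apply: lerD => //.
have -> : N%:R * (2 * gamma + eta) = 32 * a + 2 * (a / N%:R).
  by rewrite /gamma /eta; field; rewrite gt_eqF.
have : a / N%:R <= a by rewrite ler_pdivrMr// ler_peMr// ltW.
lra.
Qed.

End excess_risk.

(** * The sample size and the main estimate *)

(** Solving the implicit inequality [n >= const K L ln n] for [n]. *)
Lemma sample_size_suffices (R : realType) (c K L n : R) :
  1 <= c -> 0 < K -> 0 < n ->
  (3 * c) ^+ 2 * K * (Num.max (ln K) 1 + Num.max (ln L) 1) * Num.max L 1 <= n ->
  K * Num.max L 1 * (c * (ln n + 3)) <= 3 / 4 * n.
Proof.
move=> c1 K0 n0.
set l1 := Num.max (ln K) 1; set l2 := Num.max (ln L) 1; set L1 := Num.max L 1.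
have l11 : 1 <= l1 by rewrite /l1 le_max lexx orbT.
have l21 : 1 <= l2 by rewrite /l2 le_max lexx orbT.
have L11 : 1 <= L1 by rewrite /L1 le_max lexx orbT.
have L10 : 0 < L1 by exact: lt_le_trans L11.
have c0 : 0 < c by exact: lt_le_trans c1.
pose K1 := Num.max K 1.
have KK1 : K <= K1 by rewrite /K1 le_max lexx.
have K10 : 0 < K1 by exact: lt_le_trans KK1.
have lnK1 : ln K1 <= l1.
  by rewrite /K1 /l1; case: (leP K 1) => _; rewrite ?ln1 le_max ?ler01 ?lexx ?orbT.
have lnL1 : ln L1 <= l2.
  by rewrite /L1 /l2; case: (leP L 1) => _; rewrite ?ln1 le_max ?ler01 ?lexx ?orbT.
have lnle (x : R) : 0 < x -> ln x <= x - 1.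
  by move=> x0; have := @le_ln1Dx R (x - 1); rewrite [1 + _]addrC subrK; apply; lra.
move=> hn.
pose B := 4 * c * (K1 * L1).
have B0 : 0 < B by rewrite /B !mulr_gt0.
(* ln n <= n / B + ln B, and the first term is absorbed by n *)
have lnn : ln n <= n / B + ln B.
  have nB0 : 0 < n / B by rewrite divr_gt0.
  have -> : ln n = ln (n / B) + ln B by rewrite -lnM ?posrE// divfK// gt_eqF.
  by rewrite lerD2r; have := lnle _ nB0; lra.
have lnB : ln B <= 4 * c + (l1 + l2).
  rewrite /B lnM ?posrE ?mulr_gt0// [ln (K1 * L1)]lnM ?posrE//.
  by have := lnle (4 * c); rewrite mulr_gt0// => /(_ isT); lra.
have KL0 : 0 < K * L1 by rewrite mulr_gt0.
have h1 : K * L1 * (c * (n / B)) <= n / 4.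
  have -> : K * L1 * (c * (n / B)) = (K / K1) * (n / 4).
    by rewrite /B; field; rewrite !gt_eqF.
  by apply: ler_piMl; [rewrite divr_ge0// ltW|rewrite ler_pdivrMr// mul1r].
have h2 : K * L1 * (c * (ln n + 3)) <=
    K * L1 * (c * (n / B) + c * (4 * c + (l1 + l2) + 3)).
  by rewrite ler_pM2l// -mulrDr ler_pM2l//; lra.
have h3 : K * L1 * (c * (4 * c + (l1 + l2) + 3)) <=
    K * L1 * (c * (9 / 2 * c * (l1 + l2))).
  rewrite ler_pM2l// ler_pM2l//.
  have : c * 2 <= c * (l1 + l2) by rewrite ler_pM2l//; lra.
  have : 1 * (l1 + l2) <= c * (l1 + l2) by apply: ler_wpM2r => //; lra.
  lra.
have h4 : K * L1 * (c * (9 / 2 * c * (l1 + l2))) =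
    ((3 * c) ^+ 2 * K * (l1 + l2) * L1) / 2 by field.
rewrite mulrDr in h2; lra.
Qed.

Theorem mainTheorem2 (R : realType) :
  exists2 C : R, 0 < C &
  exists2 c : R -> R, (forall M : R, 0 < M -> 0 < c M) &
  forall (d : nat) (p : \bar R) (mu M eps sigma delta : R)
    (X : set 'rV[R]_d)
    (dO : measure_display) (Omega : measurableType dO)
    (P : probability Omega R)
    (dS : measure_display) (S : measurableType dS)
    (xi : {RV P >-> S}) (f : 'rV[R]_d -> S -> R)
    (N : nat) (xis : 'I_N -> {RV P >-> S})
    (xhat : N.-tuple S -> 'rV[R]_d),
  let F := expected_objective P xi f in
  let Fhat := fun s : N.-tuple S => empirical_objective f s in
  (1 <= d)%N -> (1 <= p)%E -> 0 < mu -> 0 < M -> 0 < eps ->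
  0 < sigma -> sigma < 1 ->
  convex_set X ->
  (forall x, X x -> measurable_fun [set: S] (f x)) ->
  (forall x, X x -> P.-integrable [set: Omega] (fun w => (f x (xi w))%:E)) ->
  (forall x s, X x -> 0 <= f x s) ->
  (forall s, convex_function X (fun x => f x s)) ->
  (forall x y s, X x -> X y ->
     `|f y s - f x s| <= M * lp_norm p (y - x)) ->
  mutually_independent P xis ->
  (forall k, same_law P (xis k) xi) ->
  C * (M ^+ 2 / (mu * eps)) *
    (Num.max (ln (M ^+ 2 / (mu * eps))) 1 + Num.max (ln (ln (1 / sigma))) 1) *
    Num.max (ln (1 / sigma)) 1 <= N%:R ->
  0 <= delta -> delta <= c M * mu * eps ^+ 2 ->
  (forall s : N.-tuple S, exists xs, solutions X (Fhat s) xs) ->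
  (exists xs, solutions X F xs) ->
  (forall s : N.-tuple S, quadratic_growth p mu X (Fhat s)) ->
  quadratic_growth p mu X F ->
  (forall s, X (xhat s)) ->
  (forall i : 'I_d, measurable_fun [set: N.-tuple S] (fun s => xhat s 0 i)) ->
  ((1 - sigma / 2)%:E <=
     P [set w | (Fhat (sample xis w) (xhat (sample xis w))
                 - minimum X (Fhat (sample xis w)) <= delta)%R])%E ->
  ((1 - sigma)%:E <=
     P [set w | (F (xhat (sample xis w)) - minimum X F <= eps)%R])%E.
Proof.
exists ((3 * (5 * 32 ^+ 2)) ^+ 2); first by rewrite !(exprn_gt0, mulr_gt0).
(* with this bound on [delta], the points at hand are within [eps / (4 M)] of an
   empirical minimizer *)
exists (fun M => (32 * M ^+ 2)^-1) => [M M0|].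
  by rewrite invr_gt0 mulr_gt0// exprn_gt0.
move=> d p mu M eps sigma delta X dO Omega P dS S xi f N xis xhat F Fhat.
move=> d1 p1 mu0 M0 eps0 sig0 sig1 _ mf intf _ _ lip ind law hN del0 delle.
move=> att attF growth _ Xxhat mxhat hP.
have [xs sxs] := attF; have [Xxs xsmin] := sxs.
have X0 : X !=set0 by exists xs.
pose a := M ^+ 2 / mu.
have a0 : 0 < a by rewrite /a divr_gt0// exprn_gt0.
pose K := M ^+ 2 / (mu * eps).
have K0 : 0 < K by rewrite /K divr_gt0 ?exprn_gt0// mulr_gt0.
have aK : a = K * eps by rewrite /a /K; field; rewrite !gt_eqF.
set L := ln (1 / sigma) in hN.
pose c : R := 32 ^+ 2.
have NR0 : 0 < N%:R :> R.
  have max0 (y : R) : 0 < Num.max y 1 by rewrite lt_max ltr01 orbT.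
  apply: lt_le_trans hN; apply: mulr_gt0 => //; apply: mulr_gt0; last exact: addr_gt0.
  by apply: mulr_gt0 => //; apply: exprn_gt0; apply: mulr_gt0 => //; apply: mulr_gt0.
have N0 : (0 < N)%N by rewrite -(ltr0n R).
have c1 : 44 <= c by rewrite /c; lra.
have c0 : 0 < c by lra.
have size : K * Num.max L 1 * (5 * c * (ln N%:R + 3)) <= 3 / 4 * N%:R.
  by apply: sample_size_suffices => //; lra.
(* a sample, used as a source of replacement observations *)
have [w0 _] : exists w : Omega, True.
  apply: contrapT => noW.
  have : P setT = 1%E by exact: probability_setT.
  rewrite (_ : setT = set0) ?measure0; first by move=> /esym/eqP; rewrite onee_eq0.
  by apply/seteqP; split => // w _; apply: noW; exists w.
have lipFhat x y s : X x -> X y -> `|Fhat s y - Fhat s x| <= M * lp_norm p (y - x).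
  by move=> Xx Xy; apply: empirical_objective_diff_le => // z; exact: lip.
have lipF x y (s : N.-tuple S) : X x -> X y -> `|F y - F x| <= M * lp_norm p (y - x).
  by move=> Xx Xy; apply: (expected_objective_diff_le mf intf) => // z; exact: lip.
have mFhat x : X x -> measurable_fun setT (fun s : N.-tuple S => Fhat s x).
  move=> Xx; apply: measurable_funM => //; apply: measurable_sum => k.
  by apply: (measurableT_comp (mf x Xx)); exact: measurable_tnth.
pose eta := 2 * a / N%:R ^+ 2.
have eta0 : 0 < eta by rewrite /eta divr_gt0 ?exprn_gt0// mulr_gt0.
have [u [idx [Xu midx hidx]]] := @exists_measurable_approx_minimizer _ _ _ _ p M X
  (fun x s => Fhat s x) p1 M0 X0 mFhat lipFhat att eta eta0.
pose tau := c * a * (ln N%:R + 2).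
have lnN0 : 0 <= ln (N%:R : R) by rewrite ln_ge0// ler1n.
have tau0 : 0 < tau.
  by rewrite /tau; apply: mulr_gt0; [exact: mulr_gt0|rewrite ltr_wpDl].
(* the deviation exceeded with probability [sigma / 2] *)
pose v := tau * ln (4 * expR 1 / sigma).
have [Z [mZ QZ] hZ] := excess_risk_tail N0 mu0 M0 mf intf lip ind law growth Xu
  midx hidx sxs (sample xis w0) (lexx c) v.
have QZ2 : (P (sample xis @^-1` Z) <= (sigma / 2)%:E)%E.
  apply: le_trans QZ _; rewrite lee_fin -/a -/tau.
  have -> : v / tau = ln (4 * expR 1 / sigma) by rewrite /v mulrAC divff ?gt_eqF// mul1r.
  rewrite expRN lnK ?posrE ?divr_gt0 ?mulr_gt0 ?expR_gt0// le_eqVlt; apply/orP; left.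
  by apply/eqP; field; rewrite !gt_eqF// expR_gt0.
(* the excess risk is at most [eps] outside the two exceptional events *)
have good s : ~ Z s -> Fhat s (xhat s) - minimum X (Fhat s) <= delta ->
    F (xhat s) - minimum X F <= eps.
  move=> nZ hs.
  have [ys sys] := att s.
  have minE : minimum X (Fhat s) = Fhat s ys := minimum_solution (phi := fun x s => Fhat s x) sys.
  have minF : minimum X F = F xs := minimum_solution (phi := fun x _ => F x) (t := tt) sxs.
  have app : approx_minimizer X (Fhat s) delta (xhat s).
    split; first exact: Xxhat.
    move=> y Xy; have := sys.2 _ Xy; move: hs; rewrite minE; lra.
  have diff : `|F (xhat s) - F (u (idx s))| <= eps / 4 + 10 * a / N%:R.
    apply: (expected_objective_diff_le mf intf) => // z.
    apply: le_trans (approx_minimizers_flat N0 mu0 M0 lip growth z del0 (ltW eta0)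
      app (hidx s)) _.
    have -> : M * Num.sqrt (2 * eta / mu) = 2 * a / N%:R.
      have -> : 2 * eta / mu = (2 * M / (mu * N%:R)) ^+ 2.
        by rewrite /eta /a; field; rewrite !gt_eqF.
      rewrite sqrtr_sqr ger0_norm; last by rewrite divr_ge0 ?mulr_ge0// ltW.
      by rewrite /a; field; rewrite !gt_eqF.
    have -> : 2 * M * (4 * M / (mu * N%:R)) = 8 * a / N%:R.
      by rewrite /a; field; rewrite !gt_eqF.
    have : M * Num.sqrt (2 * delta / mu) <= eps / 4.
      have -> : eps / 4 = M * (eps / (4 * M)) by field; rewrite gt_eqF.
      rewrite ler_pM2l//.
      have e0 : 0 <= eps / (4 * M) by rewrite divr_ge0 ?mulr_ge0// ltW.
      rewrite -[leRHS](ger0_norm e0) -sqrtr_sqr ler_sqrt ?sqr_ge0//.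
      rewrite ler_pdivrMr//; move: delle.
      have -> : (32 * M ^+ 2)^-1 * mu * eps ^+ 2 = (eps / (4 * M)) ^+ 2 * mu / 2.
        by field; rewrite gt_eqF.
      lra.
    lra.
  have risk := hZ s nZ.
  have lnb : ln (4 * expR 1 / sigma) <= 5 * Num.max L 1.
    have -> : ln (4 * expR 1 / sigma) = ln 4 + 1 + L.
      rewrite (_ : 4 * expR 1 / sigma = 4 * expR 1 * (1 / sigma)); last by rewrite mul1r.
      have e0 : 0 < 4 * expR 1 :> R by apply: mulr_gt0 => //; exact: expR_gt0.
      have s0 : 0 < 1 / sigma by rewrite divr_gt0.
      by rewrite lnM ?posrE// [ln (4 * _)]lnM ?posrE ?expR_gt0// expRK.
    have : ln (4 : R) <= 3 by have := @le_ln1Dx R 3; rewrite (_ : 1 + 3 = 4); lra.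
    have : L <= Num.max L 1 by rewrite le_max lexx.
    have : 1 <= Num.max L 1 by rewrite le_max lexx orbT.
    lra.
  have vle : v <= tau * (5 * Num.max L 1) by rewrite ler_pM2l.
  have aL : a <= a * Num.max L 1 by rewrite ler_peMr ?le_max ?lexx ?orbT// ltW.
  have total : v + 44 * a <= 3 / 4 * (eps * N%:R).
    have : eps * (K * Num.max L 1 * (5 * c * (ln N%:R + 3))) <= eps * (3 / 4 * N%:R).
      by rewrite ler_pM2l.
    have -> : eps * (K * Num.max L 1 * (5 * c * (ln N%:R + 3))) =
        tau * (5 * Num.max L 1) + 5 * c * (a * Num.max L 1) by rewrite /tau aK; ring.
    have : 44 * (a * Num.max L 1) <= c * (a * Num.max L 1).
      by apply: ler_wpM2r => //; apply: le_trans aL; exact: ltW.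
    have : 0 <= c * (a * Num.max L 1).
      by apply: mulr_ge0; [exact: ltW|apply: le_trans aL; exact: ltW].
    lra.
  have {}diff : N%:R * (F (xhat s) - F (u (idx s))) <= N%:R * (eps / 4) + 10 * a.
    have -> : N%:R * (eps / 4) + 10 * a = N%:R * (eps / 4 + 10 * a / N%:R).
      by field; rewrite gt_eqF.
    by rewrite ler_pM2l// (le_trans (ler_norm _)).
  rewrite minF -(ler_pM2l NR0).
  by move: risk; rewrite -/F -/a; lra.
pose A := [set w | Fhat (sample xis w) (xhat (sample xis w))
                 - minimum X (Fhat (sample xis w)) <= delta].
pose G := [set w | F (xhat (sample xis w)) - minimum X F <= eps].
have ms := measurable_sample xis.
have mA : measurable A.
  rewrite /A -[X in measurable X]setTI -preimage_true.
  apply: measurable_fun_ler => //.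
  apply: (measurableT_comp (f := fun s => Fhat s (xhat s) - minimum X (Fhat s)) _ ms).
  apply: measurable_funB.
    exact: (measurable_fun_lipschitz_family p1 M0 X0 mFhat lipFhat Xxhat mxhat).
  exact: (measurable_fun_minimum p1 M0 X0 mFhat lipFhat att).
have mG : measurable G.
  rewrite /G -[X in measurable X]setTI -preimage_true.
  apply: measurable_fun_ler => //; apply: measurable_funB => //.
  apply: (measurableT_comp (f := fun s => F (xhat s)) _ ms).
  have mF x : X x -> measurable_fun setT (fun _ : N.-tuple S => F x) by [].
  exact: (measurable_fun_lipschitz_family p1 M0 X0 mF lipF Xxhat mxhat).
have mZ' : measurable (sample xis @^-1` Z) by rewrite -[X in measurable X]setTI; exact: ms.
have AG : A `<=` G `|` sample xis @^-1` Z.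
  move=> w Aw; have [Zw|nZw] := pselect (Z (sample xis w)); [by right|left].
  exact: good.
have PAG : (P A <= P G + P (sample xis @^-1` Z))%E.
  apply: (@le_trans _ _ (P (G `|` sample xis @^-1` Z))).
    by apply: le_measure; rewrite ?inE//; exact: measurableU.
  exact: measureU2.
have PG : P G \is a fin_num by exact: fin_num_measure.
rewrite -/G -(fineK PG) lee_fin.
have : ((1 - sigma / 2)%:E <= (fine (P G))%:E + (sigma / 2)%:E)%E.
  apply: le_trans hP _; apply: le_trans PAG _.
  by rewrite (fineK PG) leeD2l.
rewrite -EFinD lee_fin; lra.
Qed.
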